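(* Let $E=\mathbb{R}^2$ or $E=\mathbb{R}^3$, let $n\ge2$, let $T>0$, and consider $n$ bodies of equal mass $m>0$ in $E$. If $x$ is a minimizer of the action $\mathcal{A}$ among $n$-choreographies of period $T$ in $E$, then $x(t)$ is collision-free for every $t\in\mathbb{R}$.
   Context: $E$ is a Euclidean space with norm $\|\cdot\|$. Configurations are $x=(\vec r_1,\dots,\vec r_n)\in E^n$ with center of mass at the origin, $\sum_i\vec r_i=0$. A configuration is collision-free if $\vec r_i\ne\vec r_j$ for all $i\neq j$. Loops of period $T$ are $T$-periodic paths $x(t)=(\vec r_1(t),\dots,\vec r_n(t))$ of configurations of Sobolev class $H^1_{\rm loc}$ (collisions allowed). The action of such a loop is $$\mathcal{A}(x)=\int_0^T\Big(\tfrac12\sum_i m\|\dot{\vec r}_i(t)\|^2+\sum_{i<j}\frac{m^2}{\|\vec r_i(t)-\vec r_j(t)\|}\Big)dt\in[0,+\infty].$$ An $n$-choreography of period $T$ is a loop invariant under the action of $\mathbb{Z}/n\mathbb{Z}$ whose generator cyclically permutes the bodies after one $n$-th of the period: $\vec r_{i+1}(t)=\vec r_i(t+T/n)$ for all $t$ and all $i$ (indices mod $n$). A minimizer is an $n$-choreography whose action is finite and minimal among all $n$-choreographies of period $T$. *)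

(* Defs.v *)
From HB Require Import structures.
From mathcomp Require Import all_boot all_order all_algebra.
From mathcomp Require Import all_classical all_reals all_analysis.
Set Implicit Arguments.
Unset Strict Implicit.
Unset Printing Implicit Defensive.
Import Order.TTheory GRing.Theory Num.Theory.
Import numFieldNormedType.Exports.
Local Open Scope classical_set_scope.
Local Open Scope ring_scope.

(* The library's norm on row vectors is the sup norm; it induces the same
   topology, hence the same derivatives, but the action needs this one. *)
Definition enorm (R : realType) (d : nat) (u : 'rV[R]_d) : R :=
  Num.sqrt (\sum_(k < d) u 0 k ^+ 2).

Definition configuration (R : realType) (d n : nat) := 'I_n -> 'rV[R]_d.

Definition centered (R : realType) (d n : nat) (x : configuration R d n) : Prop :=
  \sum_(i < n) x i = 0.

Definition collision_free (R : realType) (d n : nat) (x : configuration R d n) :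
    Prop :=
  forall i j : 'I_n, i != j -> x i != x j.

(* A function of one variable is of class H^1_loc when it is (the continuous
   representative given by) a primitive of a locally square-integrable
   function, its weak derivative. *)
Definition H1loc (R : realType) (f : R -> R) : Prop :=
  exists v : R -> R,
    [/\ measurable_fun [set: R] v,
        locally_integrable [set: R] (fun t => v t ^+ 2) &
        forall s t : R, s <= t ->
          f t - f s = \int[@lebesgue_measure R]_(u in `[s, t]) v u].

Definition loop (R : realType) (d n : nat) (T : R) (x : R -> configuration R d n) :
    Prop :=
  [/\ forall t, centered (x t),
      forall i, periodic (fun t => x t i) T &
      forall i k, H1loc (fun t => x t i 0 k)].

(* The pointwise derivative of an H^1_loc path exists for almost every t and
   coincides with its weak derivative, so its junk values do not matter.
   The quotient is taken in the extended reals, where the inverse of 0 is +oo: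
   the potential is +oo exactly at collisions. *)
Definition action (R : realType) (d n : nat) (m T : R)
    (x : R -> configuration R d n) : \bar R :=
  (\int[@lebesgue_measure R]_(t in `[0%R, T])
     ((2^-1 * \sum_(i < n) m * enorm (derive1 (fun s => x s i) t) ^+ 2)%R%:E
      + \sum_(i < n) \sum_(j < n | (i < j)%N)
          (m ^+ 2)%R%:E / (enorm (x t i - x t j)%R)%:E))%E.

(* [ordS] is the cyclic successor on 'I_n. *)
Definition choreography (R : realType) (d n : nat) (T : R)
    (x : R -> configuration R d n) : Prop :=
  loop T x /\ forall (t : R) (i : 'I_n), x t (ordS i) = x (t + T / n%:R) i.

Definition minimizer (R : realType) (d n : nat) (m T : R)
    (x : R -> configuration R d n) : Prop :=
  [/\ choreography T x,
      (action m T x < +oo)%E &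
      forall y : R -> configuration R d n,
        choreography T y -> (action m T x <= action m T y)%E].

(* Main.v *)
Require Import Defs.
From mathcomp Require Import all_boot all_order all_algebra.
From mathcomp Require Import all_classical all_reals all_analysis.
From mathcomp Require Import measurable_realfun.
From mathcomp Require Import ring lra.
Import Order.TTheory GRing.Theory Num.Theory.
Set Implicit Arguments.
Unset Strict Implicit.
Unset Printing Implicit Defensive.
Import numFieldNormedType.Exports.
Local Open Scope classical_set_scope.
Local Open Scope ring_scope.

(** Suppose that bodies k and j of a minimizer x are at the same place at time
    t0. For a vector s of the plane of the first two coordinates, add to body i
    the displacement cos(2 pi (t - t0) / T + 2 pi (i - k) / n) s. These
    displacements sum to zero ([sum_cos_roots]) and respect the choreography
    ([choreography_perturb]), and near t0 they change the relative position of
    k and j by a nonzero multiple of s ([wave_t0]). When the competitors for s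
    and - s are used together, the terms of the kinetic energy that are linear
    in s cancel, so the two kinetic actions exceed twice the one of x only by
    O(|s|^2) ([kinetic_parallelogram]). Hence minimality compares potentials,
    up to O(|s|^2) ([competitors_le]).

    This comparison is averaged over s = r (cos th, sin th), with th uniform
    on [0, pi], both signs of s, and r in [a, 1] with density r^-2, which also
    makes the integral of the kinetic cost bounded. Let u be the relative
    position of two bodies at some time and l the difference of the two cosines.
    The key is [mean_kernel_le]: the integral over [a, 1] x [0, pi] of
      r^-2 (1 / |u + l r e_th| + 1 / |u - l r e_th|)
    is at most (2 pi / a) / |u|, for every u and every l. As 1 / |u| is
    subharmonic in the plane, an average over circles alone would not do; the
    heavy weight of small r compensates for this. The proof is a pointwise
    divergence identity in (r, th) ([is_derive_kprim]) in which the angular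
    flux through the boundary vanishes, the radial one has the right sign and
    bound ([pair_of_quotients]), and the remainder is nonpositive.

    The total weight being 2 pi (1 / a - 1) instead of 2 pi / a, averaging
    loses only a constant independent of a. It wins near the collision: when
    |u| <= l0 a / 4 and |l| >= l0, all the displacements move the two bodies
    to a distance at least l0 a / 2, and the key inequality has a slack of
    order 1 / a^2 ([mean_kernel_gain]). A path of class H^1 satisfies
    |x_k - x_j| = o(sqrt (t - t0)) ([weak_derivative_small]), so this situation
    lasts for a time at least (K a)^2, whatever K, once a is small. The gain is
    then of order K^2 and has to stay below the constant loss ([gain_bound]),
    which is absurd for large K. *)

(** * Functions of class H^1 *)
Section weak_derivative.
Context {R : realType}.
Notation mu := (@lebesgue_measure R).
Implicit Types f v : R -> R.

Lemma itv_lty (a b : R) : (mu `[a, b] < +oo)%E.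
Proof.
by rewrite lebesgue_measure_itv /=; case: ifPn => _; rewrite ?ltry// -EFinD ltry.
Qed.

(** The class H^1_loc with the weak derivative exposed: [H1loc f] is
    [exists v, weak_derivative f v] by definition. *)
Definition weak_derivative f v :=
  [/\ measurable_fun [set: R] v,
      locally_integrable [set: R] (fun t => v t ^+ 2) &
      forall s t : R, s <= t -> f t - f s = \int[mu]_(u in `[s, t]) v u].

Lemma weak_derivative_sqr_integrable f v a b : weak_derivative f v ->
  mu.-integrable `[a, b] (fun t => (v t ^+ 2)%:E).
Proof.
move=> [mv [_ _ iv2] _]; apply/integrableP; split.
  apply/measurable_EFinP; apply: measurable_funTS; exact: measurable_funX.
by apply: iv2 => //; exact: segment_compact.
Qed.

Lemma weak_derivative_integrable f v a b : weak_derivative f v ->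
  mu.-integrable `[a, b] (EFin \o v).
Proof.
move=> wv; have iv2 := @weak_derivative_sqr_integrable f v a b wv.
have [mv _ _] := wv.
have i1 : mu.-integrable `[a, b] (fun t => (1 + v t ^+ 2)%:E).
  have -> : (fun t => (1 + v t ^+ 2)%:E) =
      (fun t => (cst 1 t)%:E + (v t ^+ 2)%:E)%E.
    by apply/funext => t /=; rewrite EFinD.
  apply: integrableD => //.
  apply: measurable_bounded_integrable => //.
    exact: itv_lty.
  exact: bounded_cst.
apply: le_integrable i1 => //.
  by apply/measurable_EFinP; apply: measurable_funTS.
move=> t _ /=; rewrite lee_fin [leRHS]ger0_norm; last by rewrite addr_ge0// sqr_ge0.
by rewrite ler_norml; apply/andP; split; nra.
Qed.

Lemma weak_derivative_locally_integrable f v : weak_derivative f v ->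
  locally_integrable [set: R] v.
Proof.
move=> wv; have [mv _ _] := wv; split => //; first exact: openT.
move=> K _ cK; have [M [_ KM]] := compact_bounded cK.
have sK : K `<=` `[- (M + 1), M + 1].
  move=> x Kx; rewrite /= in_itv /= -ler_norml.
  by apply: (KM (M + 1)) => //; rewrite ltrDl.
have iM := @weak_derivative_integrable f v (- (M + 1)) (M + 1) wv.
have mK : measurable K by exact: compact_measurable.
have /integrableP[]// : mu.-integrable K (EFin \o v).
exact: integrableS iM.
Qed.

(** Lebesgue differentiation, applied to the primitive of [v] based at - 1; a
    base point strictly below the period [0, T] makes the primitive agree with
    [f], up to a constant, on a neighbourhood of each of its points. *)
Lemma weak_derivative_ae f v : weak_derivative f v ->
  {ae mu, forall t : R, 0 <= t -> is_derive t 1 f (v t)}.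
Proof.
move=> wv; have := weak_derivative_locally_integrable wv.
move=> /(@FTC1 R v (BLeft (-1))) /=.
have iv y : mu.-integrable [set` Interval (BLeft (-1)) (BRight y)] (EFin \o v).
  exact: weak_derivative_integrable wv.
move=> /(_ iv); apply: filterS; first exact: (ae_filter_ringOfSetsType mu).
move=> t /= + t0.
have t1 : -1 < t by lra.
move=> /(_ _)[|dF F't]; first by rewrite lte_fin.
have [_ _ ftc] := wv.
have dG : is_derive t 1
    (fun y : R => f (-1) + \int[mu]_(t in `[-1, y]) v t) (v t).
  rewrite -[v t]add0r; apply: is_deriveD.
  by split => //; rewrite -derive1E.
apply: near_eq_is_derive dG.
near=> y; rewrite -ftc; first by rewrite addrC subrK.
by apply: ltW; near: y; exact: lt_nbhsr.
Unshelve. all: by end_near. Qed.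

Lemma integrable_cst_itv (a b c : R) : mu.-integrable `[a, b] (EFin \o cst c).
Proof.
apply: measurable_bounded_integrable => //; first exact: itv_lty.
exact: bounded_cst.
Qed.

Lemma fine_itv (a b : R) : a <= b -> fine (mu `[a, b]) = b - a.
Proof.
move=> ab; rewrite lebesgue_measure_itv /= lte_fin.
case: ltP => [//|ba] /=; apply/eqP; rewrite eq_sym subr_eq0.
by rewrite eq_le ab ba.
Qed.

(** The Cauchy-Schwarz inequality for the integral of [v], linearised: the
    parameter [c] is to be chosen so as to balance the two terms. *)
Lemma weak_derivative_holder f v (s t c : R) : weak_derivative f v ->
  s <= t -> 0 < c ->
  `|f t - f s| <=
    2^-1 * (c * \int[mu]_(u in `[s, t]) (v u ^+ 2) + (t - s) / c).
Proof.
move=> wv st c0; have [_ _ ->//] := wv.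
have iv := @weak_derivative_integrable f v s t wv.
have iv2 := @weak_derivative_sqr_integrable f v s t wv.
apply: le_trans; first exact: le_normr_Rintegral.
have icv2 : mu.-integrable `[s, t] (EFin \o (fun u => 2^-1 * c * v u ^+ 2)).
  by have := integrableZl _ (2^-1 * c) iv2; apply.
have ic := integrable_cst_itv s t (2^-1 * c^-1).
apply: (@le_trans _ _ (\int[mu]_(u in `[s, t])
   (2^-1 * c * v u ^+ 2 + cst (2^-1 * c^-1) u))).
  apply: le_Rintegral => //; first exact: integrable_norm.
  - by have := integrableD _ icv2 ic; apply.
  - move=> u _ /=.
    have : 0 <= (c * `|v u| - 1) ^+ 2 by exact: sqr_ge0.
    rewrite -(real_normK (num_real (v u))) => h.
    have -> : 2^-1 * c * `|v u| ^+ 2 + 2^-1 * c^-1 =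
      `|v u| + (2 * c)^-1 * (c * `|v u| - 1) ^+ 2 by field; lra.
    by rewrite lerDl mulr_ge0// invr_ge0; lra.
rewrite RintegralD// RintegralZl// Rintegral_cst//.
rewrite fine_itv// le_eqVlt; apply/orP; left; apply/eqP.
by field; lra.
Qed.

Lemma weak_derivative_continuous f v : weak_derivative f v -> continuous f.
Proof.
move=> wv x; apply/cvgrPdist_le => /= e e0.
have [M ME] : {M | M = `|x| + 1} by exists (`|x| + 1).
have [G GE] : {G | G = \int[mu]_(u in `[- M, M]) (v u ^+ 2)} by eexists.
have G0 : 0 <= G by rewrite GE; apply: Rintegral_ge0 => u _; exact: sqr_ge0.
have [c [c0 cG]] : exists c, 0 < c /\ c * G <= e.
  exists (e / (G + 1)); split; first by rewrite divr_gt0//; lra.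
  rewrite mulrAC ler_pdivrMr; last by lra.
  by rewrite ler_pM2l//; lra.
have key s t : - M <= s -> s <= t -> t <= M -> t - s <= c * e ->
    `|f t - f s| <= e.
  move=> Ms st tM tse; apply: le_trans (weak_derivative_holder wv st c0) _.
  have Gst : \int[mu]_(u in `[s, t]) (v u ^+ 2) <= G.
    rewrite GE fine_le//.
    - by apply: integrable_fin_num => //; exact: weak_derivative_sqr_integrable wv.
    - by apply: integrable_fin_num => //; exact: weak_derivative_sqr_integrable wv.
    - apply: ge0_subset_integral => //=.
      + have [mv _ _] := wv; apply/measurable_EFinP.
        by apply: measurable_funTS; exact: measurable_funX.
      + by move=> u _; rewrite lee_fin sqr_ge0.
      + by apply: subset_itvScc; rewrite bnd_simp.
  have h1 : c * \int[mu]_(u in `[s, t]) (v u ^+ 2) <= e.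
    by apply: le_trans cG; rewrite ler_wpM2l// ltW.
  have h2 : (t - s) / c <= e by rewrite ler_pdivrMr// mulrC.
  rewrite ler_pdivrMl// mulr_natl mulr2n; exact: lerD.
near=> y.
have yx1 : `|x - y| <= 1 by near: y; apply: cvgr_dist_le.
have yxe : `|x - y| <= c * e.
  by near: y; apply: cvgr_dist_le => //; exact: mulr_gt0.
have := ler_norm x; have := ler_norm (- x); rewrite normrN => x1 x2.
move: yx1 yxe; have [xy|yx] := leP x y.
  rewrite ler0_norm ?subr_le0// opprB => h1 h2; rewrite distrC.
  by apply: key => //; rewrite ?ME; lra.
rewrite gtr0_norm ?subr_gt0// => h1 h2.
by apply: key => //; rewrite ?ME; lra.
Unshelve. all: by end_near. Qed.

(** The energy on [s, s + h] tends to 0 with h, hence by Cauchy-Schwarz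
    f t - f s = o(sqrt (t - s)). Here sqrt (t - s) is compared with the scale
    [a] of the perturbations, up to an arbitrary factor [K]. *)
Lemma weak_derivative_small f v (s c K : R) : weak_derivative f v ->
  0 < c -> 0 < K ->
  \forall a \near 0^'+, forall t, s <= t <= s + (K * a) ^+ 2 ->
    `|f t - f s| <= c * a.
Proof.
move=> wv c0 K0.
pose G t := \int[mu]_(u in `[s, t]) (v u ^+ 2).
have cG : G t @[t --> s] --> 0.
  apply: (@parameterized_integral_cvg_left R s (s + 1)); first by rewrite ltrDl.
  exact: weak_derivative_sqr_integrable wv.
have sa : s + (K * a) ^+ 2 @[a --> 0^'+] --> s.
  apply: cvg_at_right_filter.
  rewrite [X in _ --> X](_ : s = s + (K * 0) ^+ 2); last first.
    by rewrite mulr0 expr0n addr0.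
  apply: cvgD; first exact: cvg_cst.
  apply: (@cvg_comp _ _ _ (fun a => K * a) (fun x => x ^+ 2)).
    by apply: cvgM; [exact: cvg_cst|exact: cvg_id].
  exact: exprn_continuous.
have e0 : 0 < c ^+ 2 / K ^+ 2 by rewrite divr_gt0// exprn_gt0.
have cGs : G (s + (K * a) ^+ 2) @[a --> 0^'+] --> 0 by exact: cvg_comp sa cG.
near=> a; move=> t /andP[st ts].
have a0 : 0 < a by near: a; exact: nbhs_right_gt.
have Gle : G (s + (K * a) ^+ 2) <= c ^+ 2 / K ^+ 2.
  apply: le_trans (ler_norm _) _; rewrite -normrN -[- _]add0r.
  by near: a; apply: cvgr_dist_le.
have Gt : G t <= c ^+ 2 / K ^+ 2.
  apply: le_trans Gle; rewrite /G fine_le//.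
  - by apply: integrable_fin_num => //; exact: weak_derivative_sqr_integrable wv.
  - by apply: integrable_fin_num => //; exact: weak_derivative_sqr_integrable wv.
  - apply: ge0_subset_integral => //=.
    + have [mv _ _] := wv; apply/measurable_EFinP.
      by apply: measurable_funTS; exact: measurable_funX.
    + by move=> u _; rewrite lee_fin sqr_ge0.
    + by apply: subset_itvScc; rewrite bnd_simp.
(* with this parameter both terms of the estimate are at most c a *)
have l0 : 0 < K ^+ 2 * a / c by rewrite divr_gt0// mulr_gt0// exprn_gt0.
apply: le_trans (weak_derivative_holder wv st l0) _.
have h1 : K ^+ 2 * a / c * G t <= c * a.
  apply: le_trans (ler_wpM2l (ltW l0) Gt) _.
  rewrite le_eqVlt; apply/orP; left; apply/eqP.
  by field; rewrite !gt_eqF.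
have h2 : (t - s) / (K ^+ 2 * a / c) <= c * a.
  rewrite ler_pdivrMr// lerBlDl; apply: le_trans ts _.
  rewrite lerD2l le_eqVlt; apply/orP; left; apply/eqP.
  by field; rewrite gt_eqF.
rewrite ler_pdivrMl// mulr_natl mulr2n; exact: lerD.
Unshelve. all: by end_near. Qed.

Lemma integral_ftc (F f : R -> R) (a b : R) : a <= b ->
  (forall x : R, a <= x <= b -> is_derive x 1 F (f x)) ->
  (forall x, a <= x <= b -> {for x, continuous f}) ->
  (\int[mu]_(x in `[a, b]) (f x)%:E = (F b - F a)%:E)%E.
Proof.
rewrite le_eqVlt => /predU1P[<- _ _|ab dF cf].
  by rewrite set_itv1 integral_set1 subrr.
have cF x : a <= x <= b -> {for x, continuous F}.
  move=> /dF dFx; apply: differentiable_continuous.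
  by apply/derivable1_diffP; exact: ex_derive.
rewrite (@continuous_FTC2 _ f F)//.
- apply: continuous_in_subspaceT => x; rewrite inE /= in_itv /= => xab.
  exact: cf.
- split.
  + by move=> x; rewrite in_itv /= => /andP[ax xb]; have [] := dF x _;
       rewrite ?(ltW ax) ?(ltW xb).
  + by apply: cvg_at_right_filter; apply: cF; rewrite lexx ltW.
  + by apply: cvg_at_left_filter; apply: cF; rewrite lexx ltW.
- move=> x; rewrite in_itv /= => /andP[ax xb]; rewrite derive1E.
  by have [] := dF x _; rewrite ?(ltW ax) ?(ltW xb).
Qed.

Lemma Rintegral_ftc (F f : R -> R) (a b : R) : a <= b ->
  (forall x : R, a <= x <= b -> is_derive x 1 F (f x)) ->
  (forall x, a <= x <= b -> {for x, continuous f}) ->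
  \int[mu]_(x in `[a, b]) f x = F b - F a.
Proof. by move=> ab dF cf; rewrite /Rintegral (integral_ftc ab dF cf). Qed.

Lemma weak_derivativeD f v (g g' : R -> R) : weak_derivative f v ->
  (forall x : R, is_derive x 1 g (g' x)) -> continuous g' ->
  weak_derivative (fun t => f t + g t) (fun t => v t + g' t).
Proof.
move=> wv dg cg'; have [mv lv ftc] := wv.
have mg' : measurable_fun [set: R] g' by exact: continuous_measurable_fun.
have mvg : measurable_fun [set: R] (fun t => v t + g' t).
  exact: measurable_funD.
split => //.
- have [m2 _ i2] := lv; split; [exact: measurable_funX|exact: openT|].
  move=> K _ cK.
  have mK : measurable K by exact: compact_measurable.
  have i2v : mu.-integrable K (EFin \o (fun t => v t ^+ 2)).
    apply/integrableP; split; last exact: i2.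
    by apply/measurable_EFinP; apply: measurable_funTS.
  have i2g : mu.-integrable K (EFin \o (fun t => g' t ^+ 2)).
    apply: continuous_compact_integrable => //.
    apply: continuous_subspaceT => x.
    apply: (@continuous_comp _ _ _ g' (fun y => y ^+ 2)); first exact: cg'.
    exact: exprn_continuous.
  have iB : mu.-integrable K
      (fun t => 2%:E * ((v t ^+ 2)%:E + (g' t ^+ 2)%:E))%E.
    by apply: integrableZl => //; exact: integrableD.
  have /integrableP[]// : mu.-integrable K
      (EFin \o (fun t => (v t + g' t) ^+ 2)).
  apply: le_integrable iB => //.
    by apply/measurable_EFinP; apply: measurable_funTS; exact: measurable_funX.
  move=> t _ /=; rewrite lee_fin.
  rewrite [leLHS]ger0_norm ?sqr_ge0//.
  rewrite [leRHS]ger0_norm; last by rewrite mulr_ge0// addr_ge0// sqr_ge0.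
  rewrite -subr_ge0 (_ : _ - _ = (v t - g' t) ^+ 2) ?sqr_ge0//.
  by ring.
- move=> s t st; rewrite RintegralD//.
  + rewrite -ftc// (@Rintegral_ftc g)//; first by ring.
    by move=> x _; exact: cg'.
  + exact: weak_derivative_integrable wv.
  + apply: continuous_compact_integrable; first exact: segment_compact.
    by apply: continuous_subspaceT => x; exact: cg'.
Qed.

End weak_derivative.

(** * The divergence identity for the averaged Newtonian potential *)
Section pair_of_quotients.
Context {R : realFieldType}.
Implicit Types B w u m s t : R.

(** By the last hypothesis the left-hand side is at most
    sqrt B x / sqrt (x^2 + B w) at x = B + u. This function of x >= 0 is
    concave, and the right-hand side is its tangent at x = B. Once squared and
    cleared of denominators, the inequality is the nonnegativity of w u^2 times
    a polynomial in B, w and B + u with nonnegative coefficients. *)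
Lemma quotient_le_tangent B w u s t : 0 < B -> 0 < w -> 0 <= B + u ->
  0 < s -> 0 < t -> t ^+ 2 = B + w -> (B + u) ^+ 2 + B * w <= B * s ^+ 2 ->
  (B + u) / s <= B / t + w * u / t ^+ 3.
Proof.
move=> B0 w0 x0 s0 t0 t2 sx.
have -> : B / t + w * u / t ^+ 3 = (B ^+ 2 + w * (B + u)) / t ^+ 3.
  have -> : B ^+ 2 + w * (B + u) = B * (B + w) + w * u by ring.
  by rewrite -t2; field; rewrite gt_eqF.
have n0 : 0 <= B ^+ 2 + w * (B + u) by rewrite addr_ge0 ?sqr_ge0// mulr_ge0// ltW.
rewrite ler_pdivrMr// mulrAC ler_pdivlMr ?exprn_gt0//.
rewrite -ler_sqr ?nnegrE; last 2 first.
- by rewrite mulr_ge0// exprn_ge0// ltW.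
- by rewrite mulr_ge0// ltW.
rewrite -(ler_pM2l B0) !exprMn t2.
apply: le_trans (_ : ((B + u) ^+ 2 + B * w) * (B ^+ 2 + w * (B + u)) ^+ 2 <= _).
  rewrite -subr_ge0.
  have -> : ((B + u) ^+ 2 + B * w) * (B ^+ 2 + w * (B + u)) ^+ 2 -
      B * ((B + u) ^+ 2 * ((B + w) * ((B + w) * (B + w)))) =
      w * u ^+ 2 * (B ^+ 2 * (2 * (B + u) + B) +
                    w * (B + u) * (B + u + 2 * B)) by ring.
  have B0' := ltW B0; have w0' := ltW w0.
  apply: mulr_ge0; first by rewrite mulr_ge0 ?sqr_ge0.
  apply: addr_ge0; apply: mulr_ge0; rewrite ?mulr_ge0 ?sqr_ge0//; lra.
rewrite [leRHS](_ : _ = B * s ^+ 2 * (B ^+ 2 + w * (B + u)) ^+ 2); last by ring.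
by rewrite ler_wpM2r ?sqr_ge0.
Qed.

(** If |u| <= B, both quotients lie below tangents whose slopes cancel. If
    u > B, the second quotient is negative, and replacing [s'] by the larger
    [s] leaves a sum independent of u in the numerators. *)
Lemma pair_of_quotients B w m u s s' t : 0 <= B -> 0 < w -> 0 <= m ->
  0 < s -> 0 < s' -> 0 < t -> t ^+ 2 = B + w ->
  s ^+ 2 = B + m + w + 2 * u -> s' ^+ 2 = B + m + w - 2 * u ->
  u ^+ 2 <= B * m ->
  0 <= (B + u) / s + (B - u) / s' <= 2 * B / t.
Proof.
wlog u0 : u s s' / 0 <= u.
  move=> h B0 w0 m0 s0 s0' t0 t2 s2 s2' um; have [u0|u0] := leP 0 u.
    exact: h.
  have := h (- u) s' s _ B0 w0 m0 s0' s0 t0 t2.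
  rewrite opprK [_ / s' + _]addrC; apply.
  - by rewrite oppr_ge0 ltW.
  - by rewrite s2' mulrN.
  - by rewrite s2 mulrN opprK.
  - by rewrite sqrrN.
move=> B0 w0 m0 s0 s0' t0 t2 s2 s2' um.
have ss' : s' <= s by rewrite -ler_sqr ?nnegrE; [rewrite s2 s2'; lra|exact: ltW|exact: ltW].
have [uB|Bu] := leP u B.
  apply/andP; split.
    apply: addr_ge0; apply: divr_ge0; [exact: addr_ge0|exact: ltW| |exact: ltW].
    by rewrite subr_ge0.
  have [B1|B1] := ltP 0 B; last first.
    have -> : B = 0 by apply: le_anti; rewrite B0 B1.
    have -> : u = 0 by apply: le_anti; rewrite u0 (le_trans uB).
    by rewrite oppr0 addr0 !mul0r mulr0 mul0r addr0.
  have h1 : (B + u) / s <= B / t + w * u / t ^+ 3.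
    apply: quotient_le_tangent => //; first by rewrite addr_ge0.
    by rewrite s2; nra.
  have h2 : (B - u) / s' <= B / t + w * (- u) / t ^+ 3.
    apply: quotient_le_tangent => //; first by rewrite subr_ge0.
    by rewrite s2'; nra.
  apply: le_trans (lerD h1 h2) _.
  rewrite le_eqVlt; apply/orP; left; apply/eqP.
  by field; rewrite gt_eqF.
have uB0 : 0 <= u - B by rewrite subr_ge0 ltW.
apply/andP; split.
  rewrite -[B - u]opprB mulNr subr_ge0 ler_pdivrMr// mulrAC ler_pdivlMr//.
  rewrite -ler_sqr ?nnegrE; last 2 first.
  - by apply: mulr_ge0 => //; exact: ltW.
  - by apply: mulr_ge0; [exact: addr_ge0|exact: ltW].
  rewrite !exprMn s2 s2' -subr_ge0.
  have -> : (B + u) ^+ 2 * (B + m + w - 2 * u) -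
    (u - B) ^+ 2 * (B + m + w + 2 * u) =
    4 * u * (B * w + (B * m - u ^+ 2)) by ring.
  apply: mulr_ge0; first exact: mulr_ge0.
  by apply: addr_ge0; rewrite ?subr_ge0//; apply: mulr_ge0 => //; exact: ltW.
apply: (@le_trans _ _ ((B + u) / s + (B - u) / s)).
  rewrite lerD2l -[B - u]opprB !mulNr lerN2.
  by rewrite ler_wpM2l// lef_pV2 ?posrE.
rewrite -mulrDl (_ : B + u + (B - u) = 2 * B); last by ring.
rewrite ler_wpM2l// ?mulr_ge0//.
rewrite lef_pV2 ?posrE// -ler_sqr ?nnegrE; [|exact: ltW|exact: ltW].
by rewrite t2 s2; lra.
Qed.

End pair_of_quotients.

Section kernel_calculus.
Context {R : realType}.
Variables (x y w : R).
Hypothesis w0 : 0 < w.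
Implicit Types l r th : R.

Let B := x ^+ 2 + y ^+ 2.
(** The vector (x, y) in the frame formed by the direction th and the direction
    orthogonal to it. *)
Definition along th := x * cos th + y * sin th.
Definition across th := y * cos th - x * sin th.
(** The distance from (x, y) to the point at - l r in the direction th, made
    positive by [w]. Besides the regularisation, [w] carries the squares of the
    coordinates orthogonal to the plane. *)
Definition sdist l r th :=
  Num.sqrt ((x + l * r * cos th) ^+ 2 + (y + l * r * sin th) ^+ 2 + w).
(** The weighted potential r^-2 / sdist, multiplied by x^2 + y^2; then the
    radial field, the angular field, its angular derivative and the remainder
    of the divergence identity [is_derive_kprim]. *)
Definition kpot l r th := B / (r ^+ 2 * sdist l r th).
Definition kprim l r th := (B + l * r * along th) / (r * sdist l r th).
Definition kflux l r th := across th / sdist l r th.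
Definition dkflux l r th := - (along th / sdist l r th) -
  l * r * across th ^+ 2 / sdist l r th ^+ 3.
Definition kreg l r th := l * w * along th / (r * sdist l r th ^+ 3).

Lemma along2_across2 th : along th ^+ 2 + across th ^+ 2 = B.
Proof.
rewrite /along /across /B; have := cos2Dsin2 th => h.
transitivity ((x ^+ 2 + y ^+ 2) * (cos th ^+ 2 + sin th ^+ 2)); first by ring.
by rewrite h mulr1.
Qed.

Lemma sdist2 l r th : sdist l r th ^+ 2 =
  B + 2 * l * r * along th + l ^+ 2 * r ^+ 2 + w.
Proof.
rewrite sqr_sqrtr; last first.
  by rewrite addr_ge0//; [rewrite addr_ge0 ?sqr_ge0|exact: ltW].
apply/eqP; rewrite -subr_eq0 /B /along.
rewrite (_ : _ - _ = l ^+ 2 * r ^+ 2 * (cos th ^+ 2 + sin th ^+ 2 - 1)).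
  by rewrite cos2Dsin2 subrr mulr0.
by ring.
Qed.

Lemma sdist_gt0 l r th : 0 < sdist l r th.
Proof. by rewrite sqrtr_gt0 ltr_wpDl// addr_ge0// sqr_ge0. Qed.

Lemma sdist_ge l r th : Num.sqrt w <= sdist l r th.
Proof. by rewrite ler_wsqrtr// lerDr addr_ge0// sqr_ge0. Qed.

Lemma is_derive_along th : is_derive th 1 along (across th).
Proof.
rewrite /along /across; apply: is_derive_eq.
by rewrite /GRing.scale /=; ring.
Qed.

Lemma is_derive_across th : is_derive th 1 across (- along th).
Proof.
rewrite /along /across; apply: is_derive_eq.
by rewrite /GRing.scale /=; ring.
Qed.

Lemma is_derive_sdist_r l r th : is_derive r 1 (fun r => sdist l r th)
  ((l * along th + l ^+ 2 * r) / sdist l r th).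
Proof.
pose g r := (x + l * r * cos th) ^+ 2 + (y + l * r * sin th) ^+ 2 + w.
have g0 : 0 < g r by rewrite ltr_wpDl// addr_ge0// sqr_ge0.
have dg : is_derive r 1 g (2 * (l * along th + l ^+ 2 * r)).
  rewrite /g /along; apply: is_derive_eq.
  apply/eqP; rewrite -subr_eq0 /GRing.scale /=.
  rewrite (_ : _ - _ = 2 * l ^+ 2 * r * (cos th ^+ 2 + sin th ^+ 2 - 1)).
    by rewrite cos2Dsin2 subrr mulr0.
  by ring.
have ds := is_derive1_sqrt g0.
have h : is_derive r 1 (fun r => sdist l r th) _ := is_derive1_comp ds dg.
apply: (is_derive_eq h).
have := sdist_gt0 l r th; rewrite /sdist -/(g r) => s0.
by field; rewrite gt_eqF.
Qed.

Lemma is_derive_sdist_th l r th : is_derive th 1 (sdist l r)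
  (l * r * across th / sdist l r th).
Proof.
pose g th := (x + l * r * cos th) ^+ 2 + (y + l * r * sin th) ^+ 2 + w.
have g0 : 0 < g th by rewrite ltr_wpDl// addr_ge0// sqr_ge0.
have dg : is_derive th 1 g (2 * (l * r * across th)).
  rewrite /g /across; apply: is_derive_eq.
  by rewrite /GRing.scale /=; ring.
have ds := is_derive1_sqrt g0.
have h : is_derive th 1 (sdist l r) _ := is_derive1_comp ds dg.
apply: (is_derive_eq h).
have := sdist_gt0 l r th; rewrite /sdist -/(g th) => s0.
by field; rewrite gt_eqF.
Qed.

Lemma is_derive_kflux l r th : is_derive th 1 (kflux l r) (dkflux l r th).
Proof.
have s0 := sdist_gt0 l r th.
have da := is_derive_across th.
have ds := is_derive_sdist_th l r th.
have dv := is_deriveV (lt0r_neq0 s0) ds.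
have h : is_derive th 1 (kflux l r) _ := is_deriveM da dv.
apply: (is_derive_eq h).
by rewrite /dkflux /GRing.scale /=; field; rewrite gt_eqF.
Qed.

(** The divergence identity: the potential is the sum of a radial derivative,
    an angular one and a remainder of order w. It rests only on the law of
    cosines [sdist2] and on the Pythagorean identity [along2_across2]. *)
Lemma is_derive_kprim l r th : 0 < r -> is_derive r 1 (fun r => kprim l r th)
  (- kpot l r th + l / r * dkflux l r th + kreg l r th).
Proof.
move=> r0; have s0 := sdist_gt0 l r th.
have ds := is_derive_sdist_r l r th.
have dn : is_derive r 1 (fun r => B + l * r * along th) (l * along th).
  by apply: is_derive_eq; rewrite /GRing.scale /=; ring.
have dd : is_derive r 1 (fun r => r * sdist l r th)
    (sdist l r th + r * ((l * along th + l ^+ 2 * r) / sdist l r th)).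
  have h : is_derive r 1 (fun r => r * sdist l r th) _ :=
    is_deriveM (is_derive_id r 1) ds.
  apply: (is_derive_eq h).
  by rewrite /GRing.scale /=; ring.
have rs0 : (fun r => r * sdist l r th) r != 0 by rewrite mulf_neq0// gt_eqF.
have h : is_derive r 1 (fun r => kprim l r th) _ :=
  is_deriveM dn
    (@is_deriveV _ (fun r => r * sdist l r th) _ _ _ rs0 dd).
apply: (is_derive_eq h).
have h1 := sdist2 l r th; have h2 := along2_across2 th.
rewrite /kpot /kreg /dkflux /GRing.scale /=.
have -> : across th ^+ 2 = B - along th ^+ 2 by rewrite -h2; ring.
have -> : w = sdist l r th ^+ 2 - (B + 2 * l * r * along th + l ^+ 2 * r ^+ 2).
  by rewrite h1; ring.
move: s0 h1; set s := sdist _ _ _ => s0 _.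
by field; rewrite !gt_eqF.
Qed.

(** The two numerators are opposite, and the positive one goes with the larger
    distance. *)
Lemma kreg_sum_le0 l r th : 0 < r -> kreg l r th + kreg (- l) r th <= 0.
Proof.
move=> r0.
have s0 := sdist_gt0 l r th; have s0' := sdist_gt0 (- l) r th.
have -> : kreg l r th + kreg (- l) r th = (w / r) * (l * along th *
    ((sdist l r th ^+ 3)^-1 - (sdist (- l) r th ^+ 3)^-1)).
  by rewrite /kreg; field; rewrite !gt_eqF.
rewrite pmulr_rle0 ?divr_gt0//.
have h1 := sdist2 l r th; have h2 := sdist2 (- l) r th.
have [la|la] := leP 0 (l * along th).
  apply: mulr_ge0_le0 => //; rewrite subr_le0 lef_pV2 ?posrE ?exprn_gt0//.
  apply: lerXn2r; rewrite ?nnegrE; [exact: ltW|exact: ltW|].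
  rewrite -ler_sqr ?nnegrE; [|exact: ltW|exact: ltW].
  by rewrite h1 h2; nra.
apply: mulr_le0_ge0; first exact: ltW.
rewrite subr_ge0 lef_pV2 ?posrE ?exprn_gt0//.
apply: lerXn2r; rewrite ?nnegrE; [exact: ltW|exact: ltW|].
rewrite -ler_sqr ?nnegrE; [|exact: ltW|exact: ltW].
by rewrite h1 h2; nra.
Qed.

(** Moving by l in the direction pi is moving by - l in the direction 0, so the
    angular boundary terms of the two signs exchange and cancel. *)
Lemma kflux_sum_eq l r :
  kflux l r pi - kflux (- l) r pi = kflux l r 0 - kflux (- l) r 0.
Proof.
have h k : sdist k r pi = sdist (- k) r 0.
  rewrite /sdist cospi sinpi cos0 sin0; congr Num.sqrt; ring.
rewrite /kflux !h opprK /across cospi sinpi cos0 sin0.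
by rewrite !mulr0 !subr0 mulrN1 mulr1 !mulNr opprK addrC.
Qed.

Let Bge0 : 0 <= B. Proof. by rewrite addr_ge0// sqr_ge0. Qed.

(** [pair_of_quotients] with m = (l r)^2 and u = l r along; the condition
    u^2 <= B m is along^2 <= x^2 + y^2. *)
Let kprim_sum l r th : 0 < r ->
  0 <= kprim l r th + kprim (- l) r th <= 2 * B / (r * Num.sqrt (B + w)).
Proof.
move=> r0; have s0 := sdist_gt0 l r th; have s0' := sdist_gt0 (- l) r th.
have Bw : 0 < B + w by rewrite ltr_wpDl.
have t0 : 0 < Num.sqrt (B + w) by rewrite sqrtr_gt0.
have -> : kprim l r th + kprim (- l) r th =
  r^-1 * ((B + l * r * along th) / sdist l r th +
          (B - l * r * along th) / sdist (- l) r th).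
  by rewrite /kprim; field; rewrite !gt_eqF.
have -> : 2 * B / (r * Num.sqrt (B + w)) = r^-1 * (2 * B / Num.sqrt (B + w)).
  by field; rewrite !gt_eqF.
have /andP[h1 h2] := @pair_of_quotients R B w (l ^+ 2 * r ^+ 2)
  (l * r * along th) _ _ _ Bge0 w0 (mulr_ge0 (sqr_ge0 l) (sqr_ge0 r))
  s0 s0' t0 (sqr_sqrtr (ltW Bw))
  (ltac:(by rewrite sdist2; ring)) (ltac:(by rewrite sdist2; ring))
  (ltac:(by rewrite -(along2_across2 th) -subr_ge0
    (_ : _ - _ = (l * r * across th) ^+ 2) ?sqr_ge0//; ring)).
by rewrite mulr_ge0 ?invr_ge0 ?(ltW r0)//= ler_wpM2l// invr_ge0 ltW.
Qed.

Lemma kprim_sum_ge0 l r th : 0 < r -> 0 <= kprim l r th + kprim (- l) r th.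
Proof. by move=> /(kprim_sum l th)/andP[]. Qed.

Lemma kprim_sum_le l r th : 0 < r ->
  kprim l r th + kprim (- l) r th <= 2 * B / (r * Num.sqrt (B + w)).
Proof. by move=> /(kprim_sum l th)/andP[]. Qed.

End kernel_calculus.

(** * Integration of nonnegative functions on rectangles *)
Section tonelli_on_rectangle.
Local Open Scope ereal_scope.
Context d1 d2 (T1 : measurableType d1) (T2 : measurableType d2) (R : realType).
Variable m1 : {sigma_finite_measure set T1 -> \bar R}.
Variable m2 : {sigma_finite_measure set T2 -> \bar R}.
Variables (f : T1 * T2 -> \bar R) (A : set T1) (B : set T2).
Hypotheses (mf : measurable_fun setT f) (f0 : forall z, 0 <= f z).
Hypotheses (mA : measurable A) (mB : measurable B).

Let g := f \_ (A `*` B).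

Let mg : measurable_fun setT g.
Proof.
apply/(measurable_restrictT f); first exact: measurableX.
exact: measurable_funTS.
Qed.

Let g0 z : 0 <= g z.
Proof. by rewrite /g patchE; case: ifP. Qed.

Lemma tonelli_rectangle1 :
  \int[m1 \x m2]_(z in A `*` B) f z =
  \int[m1]_(x in A) \int[m2]_(y in B) f (x, y).
Proof.
rewrite integral_mkcond -/g (fubini_tonelli1 g mg g0) [RHS]integral_mkcond.
apply: eq_integral => x _; rewrite /fubini_F [in RHS]patchE.
case: ifPn => [xA|xA]; last first.
  apply: integral0_eq => y _; rewrite /g patchE ifN//.
  by apply: contra xA; rewrite !inE /= => -[].
rewrite [RHS]integral_mkcond; apply: eq_integral => y _.
rewrite /g !patchE; congr (if _ then _ else _).
by apply/idP/idP; rewrite !inE /=; move: xA; rewrite inE => xA; [case|split].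
Qed.

Lemma tonelli_rectangle2 :
  \int[m1 \x m2]_(z in A `*` B) f z =
  \int[m2]_(y in B) \int[m1]_(x in A) f (x, y).
Proof.
rewrite integral_mkcond -/g (fubini_tonelli2 g mg g0) [RHS]integral_mkcond.
apply: eq_integral => y _; rewrite /fubini_G [in RHS]patchE.
case: ifPn => [yB|yB]; last first.
  apply: integral0_eq => x _; rewrite /g patchE ifN//.
  by apply: contra yB; rewrite !inE /= => -[].
rewrite [RHS]integral_mkcond; apply: eq_integral => x _.
rewrite /g !patchE; congr (if _ then _ else _).
by apply/idP/idP; rewrite !inE /=; move: yB; rewrite inE => yB; [case|split].
Qed.

Lemma tonelli_rectangle :
  \int[m1]_(x in A) \int[m2]_(y in B) f (x, y) =
  \int[m2]_(y in B) \int[m1]_(x in A) f (x, y).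
Proof. by rewrite -tonelli_rectangle1 tonelli_rectangle2. Qed.

Lemma measurable_tonelli_rectangle1 :
  measurable_fun setT (fun x => \int[m2]_(y in B) f (x, y)).
Proof.
have mg' : measurable_fun setT (f \_ (setT `*` B)).
  apply/(measurable_restrictT f); first exact: measurableX.
  exact: measurable_funTS.
have g0' z : 0 <= (f \_ (setT `*` B)) z by rewrite patchE; case: ifP.
rewrite [X in measurable_fun _ X](_ : _ = fubini_F m2 (f \_ (setT `*` B))).
  exact: measurable_fun_fubini_tonelli_F.
apply/funext => x; rewrite /fubini_F [LHS]integral_mkcond; apply: eq_integral => y _.
rewrite !patchE; congr (if _ then _ else _).
by apply/idP/idP; rewrite !inE /=; [split|case].
Qed.

End tonelli_on_rectangle.

Section tonelli_on_a_triple_product.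
Local Open Scope ereal_scope.
Context d1 d2 d3 (T1 : measurableType d1) (T2 : measurableType d2)
  (T3 : measurableType d3) (R : realType).
Variable m1 : {sigma_finite_measure set T1 -> \bar R}.
Variable m2 : {sigma_finite_measure set T2 -> \bar R}.
Variable m3 : {sigma_finite_measure set T3 -> \bar R}.

(** Exchanging an integral with one over a rectangle amounts to two exchanges
    of single variables, so that only products of two measures occur. *)
Lemma tonelli_rectangle_prod (f : T1 * (T2 * T3) -> \bar R)
    (A : set T1) (B : set T2) (C : set T3) :
  measurable_fun [set: T1 * (T2 * T3)] f -> (forall z, 0 <= f z) ->
  measurable A -> measurable B -> measurable C ->
  \int[m1]_(x in A) \int[m2 \x m3]_(z in B `*` C) f (x, z) =
  \int[m2 \x m3]_(z in B `*` C) \int[m1]_(x in A) f (x, z).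
Proof.
move=> mf f0 mA mB mC.
have comp_mf d (S : measurableType d) (g : S -> T1 * (T2 * T3)) :
    measurable_fun setT g -> measurable_fun setT (f \o g).
  exact: measurableT_comp.
have mx x : measurable_fun setT (fun z : T2 * T3 => f (x, z)).
  apply: (comp_mf _ _ (fun z => (x, z))).
  exact: measurable_fun_pair.
have mG : measurable_fun setT (fun z : T2 * T3 => \int[m1]_(x in A) f (x, z)).
  apply: (@measurable_tonelli_rectangle1 _ _ _ _ _ m1
    (fun s : (T2 * T3) * T1 => f (s.2, s.1)) A) => //.
  apply: (comp_mf _ _ (fun s : (T2 * T3) * T1 => (s.2, s.1))).
  by apply: measurable_fun_pair; [exact: measurable_snd|exact: measurable_fst].
rewrite [RHS](@tonelli_rectangle1 _ _ _ _ _ m2 m3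
  (fun z => \int[m1]_(x in A) f (x, z)) B C mG)//; last first.
  by move=> z; apply: integral_ge0.
(* the integral over the last variable, as a function of the first two *)
have mH : measurable_fun setT
    (fun s : T2 * T1 => \int[m3]_(z in C) f (s.2, (s.1, z))).
  apply: (@measurable_tonelli_rectangle1 _ _ _ _ _ m3
    (fun s : (T2 * T1) * T3 => f (s.1.2, (s.1.1, s.2))) C) => //.
  apply: (comp_mf _ _ (fun s : (T2 * T1) * T3 => (s.1.2, (s.1.1, s.2)))).
  apply: measurable_fun_pair.
    exact: (measurableT_comp measurable_snd measurable_fst).
  apply: measurable_fun_pair; last exact: measurable_snd.
  exact: (measurableT_comp measurable_fst measurable_fst).
transitivity (\int[m1]_(x in A) \int[m2]_(y in B) \int[m3]_(z in C) f (x, (y, z))).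
  apply: eq_integral => x _.
  by rewrite (@tonelli_rectangle1 _ _ _ _ _ m2 m3 (fun z => f (x, z)) B C (mx x)).
rewrite -(@tonelli_rectangle _ _ _ _ _ m2 m1
  (fun s : T2 * T1 => \int[m3]_(z in C) f (s.2, (s.1, z))) B A mH)//; last first.
  by move=> s; apply: integral_ge0.
apply: eq_integral => y _ /=.
apply: (@tonelli_rectangle _ _ _ _ _ m1 m3
  (fun s : T1 * T3 => f (s.1, (y, s.2))) A C) => //.
apply: (comp_mf _ _ (fun s : T1 * T3 => (s.1, (y, s.2)))).
apply: measurable_fun_pair; first exact: measurable_fst.
by apply: measurable_fun_pair => //; exact: measurable_snd.
Qed.

Lemma measurable_tonelli_rectangle_prod (f : T1 * (T2 * T3) -> \bar R)
    (B : set T2) (C : set T3) :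
  measurable_fun [set: T1 * (T2 * T3)] f -> (forall z, 0 <= f z) ->
  measurable B -> measurable C ->
  measurable_fun setT (fun x => \int[m2 \x m3]_(z in B `*` C) f (x, z)).
Proof.
move=> mf f0 mB mC.
have mH : measurable_fun setT
    (fun s : T1 * T2 => \int[m3]_(z in C) f (s.1, (s.2, z))).
  apply: (@measurable_tonelli_rectangle1 _ _ _ _ _ m3
    (fun s : (T1 * T2) * T3 => f (s.1.1, (s.1.2, s.2))) C) => //.
  apply: (@measurableT_comp _ _ _ _ _ _ f) => //.
  apply: measurable_fun_pair.
    exact: (measurableT_comp measurable_fst measurable_fst).
  apply: measurable_fun_pair; last exact: measurable_snd.
  exact: (measurableT_comp measurable_snd measurable_fst).
rewrite [X in measurable_fun _ X](_ : _ = fun x =>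
    \int[m2]_(y in B) \int[m3]_(z in C) f (x, (y, z))).
  apply: (@measurable_tonelli_rectangle1 _ _ _ _ _ m2
    (fun s : T1 * T2 => \int[m3]_(z in C) f (s.1, (s.2, z))) B) => //.
  by move=> s; apply: integral_ge0.
apply/funext => x.
have mx : measurable_fun setT (fun z : T2 * T3 => f (x, z)).
  by apply: (@measurableT_comp _ _ _ _ _ _ f) => //; exact: measurable_fun_pair.
by rewrite (@tonelli_rectangle1 _ _ _ _ _ m2 m3 (fun z => f (x, z)) B C mx).
Qed.

End tonelli_on_a_triple_product.

(** * Measurability and continuity of the kernels *)
Section measurability.
Context {R : realType}.

(** The inverse is discontinuous at 0, but 1 / x = x (x^2)^(-1), where the real
    power is a measurable function. *)
Lemma measurable_invr : measurable_fun [set: R] (@GRing.inv R).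
Proof.
have -> : @GRing.inv R = (fun x => x * (x ^+ 2) `^ (-1)).
  apply/funext => x; rewrite powR_inv1 ?sqr_ge0//.
  by have [->|x0] := eqVneq x 0; [rewrite invr0 mul0r|field].
apply: measurable_funM => //.
apply: (@measurableT_comp _ _ _ _ _ _ (fun u => u `^ (-1))).
  exact: measurable_powR.
exact: exprn_measurable.
Qed.

Lemma measurable_sqrt : measurable_fun [set: R] (@Num.sqrt R).
Proof. by apply: continuous_measurable_fun; exact: sqrt_continuous. Qed.

Lemma measurable_cos : measurable_fun [set: R] (@cos R).
Proof. by apply: continuous_measurable_fun; exact: continuous_cos. Qed.

Lemma measurable_sin : measurable_fun [set: R] (@sin R).
Proof. by apply: continuous_measurable_fun; exact: continuous_sin. Qed.

Context d (T : measurableType d).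
Implicit Types f : T -> R.

Lemma measurable_funV f : measurable_fun setT f ->
  measurable_fun setT (fun z => (f z)^-1).
Proof. exact: measurableT_comp measurable_invr. Qed.

Lemma measurable_fun_sqrt f : measurable_fun setT f ->
  measurable_fun setT (fun z => Num.sqrt (f z)).
Proof. exact: measurableT_comp measurable_sqrt. Qed.

Lemma measurable_fun_cos f : measurable_fun setT f ->
  measurable_fun setT (fun z => cos (f z)).
Proof. exact: measurableT_comp measurable_cos. Qed.

Lemma measurable_fun_sin f : measurable_fun setT f ->
  measurable_fun setT (fun z => sin (f z)).
Proof. exact: measurableT_comp measurable_sin. Qed.

End measurability.

Ltac measurability := repeat first
  [ exact: measurable_cst | exact: measurable_fst | exact: measurable_snd
  | exact: measurable_id
  | apply: measurable_funV | apply: measurable_fun_sqrt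
  | apply: measurable_fun_cos | apply: measurable_fun_sin
  | apply: measurable_funX
  | apply: measurable_funM | apply: measurable_funB | apply: measurable_funD
  | apply: measurable_funN ].

Section kernel_measurable.
Context {R : realType} (x y w l : R).
Notation TR := (measurableTypeR R).

Lemma measurable_kpot :
  measurable_fun [set: TR * TR] (fun z => kpot x y w l z.1 z.2).
Proof. rewrite /kpot /sdist. measurability. Qed.

Lemma measurable_dkflux :
  measurable_fun [set: TR * TR] (fun z => dkflux x y w l z.1 z.2).
Proof. rewrite /dkflux /along /across /sdist. measurability. Qed.

Lemma measurable_kreg :
  measurable_fun [set: TR * TR] (fun z => kreg x y w l z.1 z.2).
Proof. rewrite /kreg /along /sdist. measurability. Qed.

End kernel_measurable.

Section continuity_at_a_point.
Context {R : realType} (t : R).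
Implicit Types f g : R -> R.

Lemma for_continuous_cst (c : R) : {for t, continuous (fun=> c)}.
Proof. exact: cvg_cst. Qed.

Lemma for_continuous_id : {for t, continuous (fun u : R => u)}.
Proof. exact: cvg_id. Qed.

Lemma for_continuousN f : {for t, continuous f} ->
  {for t, continuous (fun u => - f u)}.
Proof. exact: cvgN. Qed.

Lemma for_continuousD f g : {for t, continuous f} -> {for t, continuous g} ->
  {for t, continuous (fun u => f u + g u)}.
Proof. exact: cvgD. Qed.

Lemma for_continuousM f g : {for t, continuous f} -> {for t, continuous g} ->
  {for t, continuous (fun u => f u * g u)}.
Proof. exact: cvgM. Qed.

Lemma for_continuousX f n : {for t, continuous f} ->
  {for t, continuous (fun u => f u ^+ n)}.
Proof.
by move=> cf; apply: (@continuous_comp _ _ _ f (fun u => u ^+ n)) => //;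
  exact: exprn_continuous.
Qed.

Lemma for_continuousV f : f t != 0 -> {for t, continuous f} ->
  {for t, continuous (fun u => (f u)^-1)}.
Proof. by move=> ft0 cf; exact: cvgV. Qed.

End continuity_at_a_point.

Section kernel_continuity.
Context {R : realType}.
Variables (x y w : R).
Hypothesis w0 : 0 < w.
Implicit Types l r th : R.

Lemma is_derive_continuous (f : R -> R) (t df : R) :
  is_derive t 1 f df -> {for t, continuous f}.
Proof.
by move=> dft; apply: differentiable_continuous; apply/derivable1_diffP.
Qed.

Let s_th l r th : {for th, continuous (sdist x y w l r)}.
Proof. exact: is_derive_continuous (is_derive_sdist_th x y w0 l r th). Qed.

Let s_r l r th : {for r, continuous (fun r => sdist x y w l r th)}.
Proof. exact: is_derive_continuous (is_derive_sdist_r x y w0 l r th). Qed.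

Let a_th th : {for th, continuous (along x y)}.
Proof. exact: is_derive_continuous (is_derive_along x y th). Qed.

Let c_th th : {for th, continuous (across x y)}.
Proof. exact: is_derive_continuous (is_derive_across x y th). Qed.

Let s_neq0 l r th : sdist x y w l r th != 0.
Proof. by rewrite gt_eqF// sdist_gt0. Qed.

Let V3_th l r th : {for th, continuous (fun th => (sdist x y w l r th ^+ 3)^-1)}.
Proof.
apply: for_continuousV; first by rewrite expf_neq0.
by apply: for_continuousX; exact: s_th.
Qed.

Let V3_r l r th : {for r, continuous (fun r => (sdist x y w l r th ^+ 3)^-1)}.
Proof.
apply: for_continuousV; first by rewrite expf_neq0.
by apply: for_continuousX; exact: s_r.
Qed.

Let cstM (t c : R) (f : R -> R) : {for t, continuous f} ->
  {for t, continuous (fun u => c * f u)}.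
Proof. by move=> cf; apply: for_continuousM => //; exact: for_continuous_cst. Qed.

Let Mcst (t c : R) (f : R -> R) : {for t, continuous f} ->
  {for t, continuous (fun u => f u * c)}.
Proof. by move=> cf; apply: for_continuousM => //; exact: for_continuous_cst. Qed.

Lemma continuous_kpot_th l r th : 0 < r ->
  {for th, continuous (kpot x y w l r)}.
Proof.
move=> r0; have rn0 : r != 0 by rewrite gt_eqF.
apply: (@cstM th _ (fun th => (r ^+ 2 * sdist x y w l r th)^-1)).
apply: for_continuousV; first by rewrite mulf_neq0// expf_neq0.
by apply: cstM; exact: s_th.
Qed.

Lemma continuous_dkflux_th l r th : {for th, continuous (dkflux x y w l r)}.
Proof.
apply: (@for_continuousD _ _ (fun th => - (along x y th / sdist x y w l r th))
  (fun th => - (l * r * across x y th ^+ 2 / sdist x y w l r th ^+ 3))).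
  apply/for_continuousN/for_continuousM; first exact: a_th.
  by apply: for_continuousV => //; exact: s_th.
apply/for_continuousN/for_continuousM; last exact: V3_th.
by apply: cstM; apply: for_continuousX; exact: c_th.
Qed.

Lemma continuous_kpot_r l r th : 0 < r ->
  {for r, continuous (fun r => kpot x y w l r th)}.
Proof.
move=> r0; have rn0 : r != 0 by rewrite gt_eqF.
apply: (@cstM r _ (fun r => (r ^+ 2 * sdist x y w l r th)^-1)).
apply: for_continuousV; first by rewrite mulf_neq0// expf_neq0.
apply: for_continuousM; last exact: s_r.
by apply: for_continuousX; exact: for_continuous_id.
Qed.

Lemma continuous_dkflux_r l r th :
  {for r, continuous (fun r => dkflux x y w l r th)}.
Proof.
apply: (@for_continuousD _ _ (fun r => - (along x y th / sdist x y w l r th))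
  (fun r => - (l * r * across x y th ^+ 2 / sdist x y w l r th ^+ 3))).
  apply/for_continuousN/cstM.
  by apply: for_continuousV => //; exact: s_r.
apply/for_continuousN/for_continuousM; last exact: V3_r.
by apply: Mcst; apply: cstM; exact: for_continuous_id.
Qed.

Lemma continuous_kreg_r l r th : 0 < r ->
  {for r, continuous (fun r => kreg x y w l r th)}.
Proof.
move=> r0; have rn0 : r != 0 by rewrite gt_eqF.
apply: (@cstM r _ (fun r => (r * sdist x y w l r th ^+ 3)^-1)).
apply: for_continuousV; first by rewrite mulf_neq0// expf_neq0.
apply: for_continuousM; first exact: for_continuous_id.
by apply: for_continuousX; exact: s_r.
Qed.

End kernel_continuity.

(** * The averaged potential: the regularised case *)
Section kernel_integral.
Context {R : realType}.
Notation TR := (measurableTypeR R).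
Notation mu := (@lebesgue_measure R).
Variables (x y w l a : R).
Hypotheses (w0 : 0 < w) (a0 : 0 < a) (a1 : a <= 1).
Let B := x ^+ 2 + y ^+ 2.

Let pot r th := kpot x y w l r th + kpot x y w (- l) r th.
Let flux r th := l / r * (dkflux x y w l r th - dkflux x y w (- l) r th).
Let reg r th := kreg x y w l r th + kreg x y w (- l) r th.
Let prim r th := kprim x y w l r th + kprim x y w (- l) r th.

Let B0 : 0 <= B. Proof. by rewrite addr_ge0// sqr_ge0. Qed.

Let pot_ge0 r th : 0 <= pot r th.
Proof.
by rewrite addr_ge0// divr_ge0// mulr_ge0 ?sqr_ge0// ltW// sdist_gt0.
Qed.

(** The flux has no sign; adding a bound for it makes all the integrands
    nonnegative, so that the order of integration may be exchanged. *)
Let flux_bound : exists2 C, 0 <= C &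
  forall r th, a <= r <= 1 -> `|flux r th| <= C.
Proof.
have sw : 0 < Num.sqrt w by rewrite sqrtr_gt0.
pose M := (1 + B) / Num.sqrt w + `|l| * B / Num.sqrt w ^+ 3.
have M0 : 0 <= M.
  apply: addr_ge0; apply: divr_ge0; rewrite ?exprn_ge0 ?(ltW sw)//.
    by rewrite addr_ge0.
  by rewrite mulr_ge0.
have dM k r th : `|k| = `|l| -> a <= r <= 1 -> `|dkflux x y w k r th| <= M.
  move=> kl /andP[ar r1]; have r0 : 0 <= r by rewrite (le_trans (ltW a0)).
  have s0 := sdist_gt0 x y w0 k r th; have sws := sdist_ge x y w k r th.
  have ab := along2_across2 x y th; rewrite -/B in ab.
  apply: le_trans (ler_normB _ _) _; rewrite normrN; apply: lerD.
    rewrite normrM normfV (gtr0_norm s0); apply: ler_pM => //.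
    - by rewrite invr_ge0 ltW.
    - by rewrite ler_norml; apply/andP; split; nra.
    - by rewrite lef_pV2 ?posrE.
  rewrite normrM normfV (gtr0_norm (exprn_gt0 3 s0)); apply: ler_pM => //.
  - by rewrite invr_ge0 exprn_ge0 ?ltW.
  - rewrite normrM (ger0_norm (sqr_ge0 _)) normrM kl (ger0_norm r0).
    rewrite -mulrA ler_wpM2l//.
    apply: (@le_trans _ _ (1 * across x y th ^+ 2)).
      by rewrite ler_wpM2r ?sqr_ge0.
    by rewrite mul1r -ab lerDr sqr_ge0.
  - rewrite lef_pV2 ?posrE ?exprn_gt0//.
    by apply: lerXn2r; rewrite ?nnegrE; [exact: ltW|exact: ltW|].
exists (`|l| / a * (M + M)).
  by apply: mulr_ge0; [apply: divr_ge0 => //; exact: ltW|exact: addr_ge0].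
move=> r th /[dup] ar1 /andP[ar r1].
have r0 : 0 < r by rewrite (lt_le_trans a0).
rewrite normrM; apply: ler_pM => //.
  rewrite normrM normfV (gtr0_norm r0) ler_wpM2l// lef_pV2 ?posrE//.
apply: le_trans (ler_normB _ _) _.
by apply: lerD; apply: dM; rewrite ?normrN.
Qed.

Let dprim (r th : R) : 0 < r -> is_derive r 1 (fun r => - prim r th)
  (pot r th - flux r th - reg r th).
Proof.
move=> r0; have d1 := is_derive_kprim x y w0 l th r0.
have d2 := is_derive_kprim x y w0 (- l) th r0.
have h : is_derive r 1 (fun r => - prim r th) _ := is_deriveN (is_deriveD d1 d2).
by apply: (is_derive_eq h); rewrite /pot /flux /reg; ring.
Qed.

Let pi0 : 0 <= pi :> R. Proof. exact: pi_ge0. Qed.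

Let flux_itv (r th : R) : 0 < r -> {for th, continuous (flux r)}.
Proof.
move=> r0; rewrite /flux; apply: for_continuousM; first exact: for_continuous_cst.
by apply: for_continuousD; [|apply: for_continuousN];
  exact: continuous_dkflux_th.
Qed.

Let pot_th (r th : R) : 0 < r -> {for th, continuous (pot r)}.
Proof.
by move=> r0; apply: for_continuousD; exact: continuous_kpot_th.
Qed.

Let int_flux r : 0 < r -> \int[mu]_(th in `[0, pi]) flux r th = 0.
Proof.
move=> r0.
have dk (th : R) : is_derive th 1 (fun th => l / r *
    (kflux x y w l r th - kflux x y w (- l) r th)) (flux r th).
  have d1 := is_derive_kflux x y w0 l r th.
  have d2 := is_derive_kflux x y w0 (- l) r th.
  have h := is_deriveM (is_derive_cst (l / r) th 1) (is_deriveB d1 d2).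
  have {}h : is_derive th 1 (fun th => l / r *
    (kflux x y w l r th - kflux x y w (- l) r th)) _ := h.
  by apply: (is_derive_eq h); rewrite /flux /GRing.scale /=; ring.
have -> := Rintegral_ftc pi0 (fun th _ => dk th) (fun th _ => @flux_itv r th r0).
by rewrite kflux_sum_eq subrr.
Qed.

Let itv_integrable (f : R -> R) :
  (forall th, {for th, continuous f}) ->
  mu.-integrable `[0, pi] (EFin \o f).
Proof.
move=> cf; apply: continuous_compact_integrable; first exact: segment_compact.
by apply: continuous_subspaceT => th; exact: cf.
Qed.

Let mpot : measurable_fun [set: TR * TR] (fun z => pot z.1 z.2).
Proof. by apply: measurable_funD; exact: measurable_kpot. Qed.

Let mflux : measurable_fun [set: TR * TR] (fun z => flux z.1 z.2).
Proof.
apply: measurable_funM.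
  apply: measurable_funM => //; apply: measurable_funV; exact: measurable_fst.
by apply: measurable_funB; exact: measurable_dkflux.
Qed.

Let mreg : measurable_fun [set: TR * TR] (fun z => reg z.1 z.2).
Proof. by apply: measurable_funD; exact: measurable_kreg. Qed.

(** The radial derivative of - [prim], made nonnegative by a constant. *)
Let dprimC C (z : TR * TR) : R := pot z.1 z.2 - flux z.1 z.2 - reg z.1 z.2 + C.

Let mdprimC C : measurable_fun [set: TR * TR] (dprimC C).
Proof.
apply: measurable_funD => //; apply: measurable_funB => //.
exact: measurable_funB.
Qed.

Let section_measurable (f : TR * TR -> R) r D : measurable_fun setT f ->
  measurable_fun D (fun th : TR => (f (r, th))%:E).
Proof.
move=> mf; apply/measurable_EFinP; apply: measurable_funTS.
exact: (measurableT_comp mf (measurable_pair1 r)).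
Qed.

(** For fixed r the flux has integral 0 over [0, pi], and the remainder that is
    dropped is nonpositive. *)
Let int_pot_le (r C : R) : 0 <= C -> a <= r <= 1 ->
  (forall th, `|flux r th| <= C) ->
  (\int[mu]_(th in `[0%R, pi]) (pot r th + C)%:E <=
   \int[mu]_(th in `[0%R, pi]) (dprimC C (r, th))%:E)%E.
Proof.
move=> C0 /andP[ar r1] fC; have r0 : 0 < r by rewrite (lt_le_trans a0).
have ip : mu.-integrable `[0, pi] (EFin \o (fun th => pot r th + C)).
  apply: itv_integrable => // th; apply: for_continuousD; first exact: pot_th.
  exact: for_continuous_cst.
have ifl : mu.-integrable `[0, pi] (EFin \o flux r).
  by apply: itv_integrable => // th; exact: flux_itv.
have -> : (\int[mu]_(th in `[0%R, pi]) (pot r th + C)%:E =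
    \int[mu]_(th in `[0%R, pi]) (pot r th + C - flux r th)%:E)%E.
  have E : \int[mu]_(th in `[0%R, pi]) (pot r th + C - flux r th) =
      \int[mu]_(th in `[0%R, pi]) (pot r th + C).
    by rewrite RintegralB// int_flux// subr0.
  have id : mu.-integrable `[0%R, pi]
      (EFin \o (fun th => pot r th + C - flux r th)).
    by have := integrableB _ ip ifl; apply.
  have fp := integrable_fin_num _ ip; have fd := integrable_fin_num _ id.
  by rewrite -[LHS]fineK ?fp// -[RHS]fineK ?fd//; congr EFin; exact/esym.
have ge0 th : 0 <= pot r th + C - flux r th.
  by rewrite -addrA addr_ge0// subr_ge0 (le_trans (ler_norm _)).
have le th : pot r th + C - flux r th <= dprimC C (r, th).
  by have := kreg_sum_le0 x y w0 l th r0; rewrite -/(reg r th) /dprimC /=; lra.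
apply: ge0_le_integral => //=.
- by move=> th _; rewrite lee_fin.
- apply: (@section_measurable (fun z => pot z.1 z.2 + C - flux z.1 z.2)).
  by apply: measurable_funB => //; exact: measurable_funD.
- exact: section_measurable.
- by move=> th _; rewrite lee_fin.
Qed.

Let int_dprim (th C : R) : (\int[mu]_(r in `[a, 1%R]) (dprimC C (r, th))%:E =
  (prim a th - prim 1 th + C * (1 - a))%:E)%E.
Proof.
have dP (r : R) : a <= r <= 1 ->
    is_derive r 1 (fun r => - prim r th + C * r) (dprimC C (r, th)).
  move=> /andP[ar _]; have r0 : 0 < r by rewrite (lt_le_trans a0).
  have h := is_deriveD (@dprim r th r0)
    (is_deriveM (is_derive_cst C r 1) (is_derive_id r 1)).
  have {}h : is_derive r 1 (fun r => - prim r th + C * r) _ := h.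
  by apply: (is_derive_eq h); rewrite /dprimC /GRing.scale /=; ring.
have cP (r : R) : a <= r <= 1 -> {for r, continuous (fun r => dprimC C (r, th))}.
  move=> /andP[ar _]; have r0 : 0 < r by rewrite (lt_le_trans a0).
  rewrite /dprimC /=; apply: for_continuousD; last exact: for_continuous_cst.
  apply: for_continuousD; last first.
    by apply/for_continuousN/for_continuousD; exact: continuous_kreg_r.
  apply: for_continuousD.
    by apply: for_continuousD; exact: continuous_kpot_r.
  apply/for_continuousN/for_continuousM.
    apply: for_continuousM; first exact: for_continuous_cst.
    by apply: for_continuousV; [rewrite gt_eqF|exact: for_continuous_id].
  by apply: for_continuousD; [|apply: for_continuousN];
    exact: continuous_dkflux_r.
by rewrite (integral_ftc a1 dP cP); congr EFin; ring.
Qed.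

Let I := `[a, 1]%classic : set TR.
Let J := `[0, pi]%classic : set TR.
Let mI : measurable I. Proof. exact: measurable_itv. Qed.
Let mJ : measurable J. Proof. exact: measurable_itv. Qed.

Let integral_cst_rect (C : R) :
  (\int[mu]_(r in I) \int[mu]_(th in J) C%:E = (C * pi * (1 - a))%:E)%E.
Proof.
rewrite /I /J; under eq_integral do rewrite integral_cst//=.
rewrite integral_cst//=.
rewrite -(fineK (_ : mu `[0%R, pi] \is a fin_num)%E); last first.
  by rewrite ge0_fin_numE// itv_lty.
rewrite -(fineK (_ : mu `[a, 1%R] \is a fin_num)%E); last first.
  by rewrite ge0_fin_numE// itv_lty.
by rewrite !fine_itv// subr0 -!EFinM.
Qed.

Let int_kpot_le (C : R) : 0 <= C ->
    (forall r th, a <= r <= 1 -> `|flux r th| <= C) ->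
  (\int[mu]_(r in I) \int[mu]_(th in J) (pot r th + C)%:E <=
   ((2 * B / (a * Num.sqrt (B + w)) + C * (1 - a)) * pi)%:E)%E.
Proof.
move=> C0 fC.
(* truncated at 0, since nonnegativity is known only for a <= r <= 1 *)
pose p (z : TR * TR) := maxe 0%E (dprimC C z)%:E.
have mp : measurable_fun setT p.
  apply: measurable_maxe => //; apply/measurable_EFinP; exact: mdprimC.
have p0 z : (0 <= p z)%E by rewrite /p le_max lexx.
have pE r th : a <= r <= 1 -> p (r, th) = (dprimC C (r, th))%:E.
  move=> ar1; apply/max_idPr; rewrite lee_fin.
  have r0 : 0 < r by case/andP: ar1 => ar _; rewrite (lt_le_trans a0).
  have := fC _ th ar1; rewrite ler_norml => /andP[_ f1].
  have := kreg_sum_le0 x y w0 l th r0; rewrite -/(reg r th) => h.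
  by have := pot_ge0 r th; rewrite /dprimC /=; lra.
pose q (z : TR * TR) := (pot z.1 z.2 + C)%:E.
have mq : measurable_fun setT q.
  by apply/measurable_EFinP; exact: measurable_funD.
have q0 z : (0 <= q z)%E by rewrite lee_fin addr_ge0.
apply: (@le_trans _ _ (\int[mu]_(r in I) \int[mu]_(th in J) p (r, th))%E).
  apply: ge0_le_integral.
  - exact: measurable_itv.
  - by move=> r _; apply: integral_ge0 => th _; exact: (q0 (r, th)).
  - apply: measurable_funTS.
    exact: (@measurable_tonelli_rectangle1 _ _ _ _ _ mu q J mq q0 mJ).
  - apply: measurable_funTS.
    exact: (@measurable_tonelli_rectangle1 _ _ _ _ _ mu p J mp p0 mJ).
  - move=> r; rewrite /I /= in_itv /= => ar1.
    apply: (le_trans (int_pot_le C0 ar1 (fun th => fC r th ar1))).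
    rewrite le_eqVlt; apply/orP; left; apply/eqP.
    by apply: eq_integral => th _; rewrite pE.
rewrite (@tonelli_rectangle _ _ _ _ _ mu mu p I J mp p0 mI mJ).
have -> : ((2 * B / (a * Num.sqrt (B + w)) + C * (1 - a)) * pi)%:E =
  (\int[mu]_(th in J) (2 * B / (a * Num.sqrt (B + w)) + C * (1 - a))%:E)%E.
  rewrite /J integral_cst//=.
  rewrite -(fineK (_ : mu `[0%R, pi] \is a fin_num)%E); last first.
    by rewrite ge0_fin_numE// itv_lty.
  by rewrite fine_itv// subr0 -EFinM.
have c0 : 0 <= 2 * B / (a * Num.sqrt (B + w)) + C * (1 - a).
  apply: addr_ge0; last by rewrite mulr_ge0 ?subr_ge0.
  by apply: divr_ge0; [rewrite mulr_ge0|rewrite mulr_ge0 ?sqrtr_ge0 ?ltW].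
apply: ge0_le_integral.
- exact: measurable_itv.
- by move=> th _; apply: integral_ge0 => r _; exact: p0.
- apply: measurable_funTS.
  have mp' : measurable_fun setT (fun z : TR * TR => p (z.2, z.1)).
    apply: (measurableT_comp mp); apply: measurable_fun_pair;
      [exact: measurable_snd|exact: measurable_fst].
  exact: (@measurable_tonelli_rectangle1 _ _ _ _ _ mu
    (fun z : TR * TR => p (z.2, z.1)) I mp' (fun z => p0 _) mI).
- by [].
- move=> th _.
  rewrite (_ : (\int[mu]_(r in I) p (r, th))%E =
    \int[mu]_(r in I) (dprimC C (r, th))%:E)%E; last first.
    by apply: eq_integral => r; rewrite inE /I /= in_itv /= => /pE.
  rewrite /I int_dprim lee_fin.
  have := kprim_sum_ge0 x y w0 l th ltr01; rewrite -/(prim 1 th) => h1.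
  have := kprim_sum_le x y w0 l th a0; rewrite -/(prim a th) => h2.
  by rewrite lerD2r; apply: le_trans h2; rewrite lerBlDr lerDl.
Qed.

Lemma kpot_integral_le :
  (\int[mu]_(r in I) \int[mu]_(th in J) (pot r th)%:E <=
   (2 * B / (a * Num.sqrt (B + w)) * pi)%:E)%E.
Proof.
have [C C0 fC] := flux_bound.
have := int_kpot_le C0 fC.
have mpot1 : measurable_fun setT (fun z : TR * TR => (pot z.1 z.2)%:E).
  exact/measurable_EFinP.
have -> : (\int[mu]_(r in I) \int[mu]_(th in J) (pot r th + C)%:E =
    \int[mu]_(r in I) \int[mu]_(th in J) (pot r th)%:E +
    (C * pi * (1 - a))%:E)%E.
  rewrite -integral_cst_rect -ge0_integralD//.
  - apply: eq_integral => r _; rewrite -ge0_integralD//.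
    + by move=> th _; rewrite lee_fin.
    + exact: (@section_measurable (fun z => pot z.1 z.2)).
  - by move=> r _; apply: integral_ge0 => th _; rewrite lee_fin.
  - apply: measurable_funTS.
    by apply: (@measurable_tonelli_rectangle1 _ _ _ _ _ mu _ J mpot1 _ mJ)
      => z; rewrite lee_fin.
  - by move=> r _; apply: integral_ge0 => th _; rewrite lee_fin.
have -> : (2 * B / (a * Num.sqrt (B + w)) + C * (1 - a)) * pi =
  2 * B / (a * Num.sqrt (B + w)) * pi + C * pi * (1 - a) by ring.
by rewrite EFinD leeD2rE.
Qed.

End kernel_integral.

(** * The averaged potential: the singular case *)
Section inverse_sqrt.
Context {R : realType}.
Implicit Types u : R.

(** As in the potential of the action, the value at 0 is + oo. *)
Definition invsqrt u : \bar R := (((Num.sqrt u)%:E)^-1)%E.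

Lemma invsqrt_ge0 u : (0 <= invsqrt u)%E.
Proof. by rewrite /invsqrt inve_ge0 lee_fin sqrtr_ge0. Qed.

Lemma invsqrt_gt0E u : 0 < u -> invsqrt u = ((Num.sqrt u)^-1)%:E.
Proof. by move=> u0; rewrite /invsqrt inver gt_eqF// sqrtr_gt0. Qed.

Lemma invsqrt0 : invsqrt 0 = +oo%E.
Proof. by rewrite /invsqrt sqrtr0 inve0. Qed.

Lemma le_invsqrt u u' : 0 <= u -> u <= u' -> (invsqrt u' <= invsqrt u)%E.
Proof.
rewrite le_eqVlt => /predU1P[<- _|u0 uu']; first by rewrite invsqrt0 leey.
rewrite !invsqrt_gt0E//; last exact: lt_le_trans uu'.
by rewrite lee_fin lef_pV2 ?posrE ?sqrtr_gt0 ?(lt_le_trans u0)// ler_wsqrtr.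
Qed.

Lemma invsqrt_cvg u : 0 <= u ->
  invsqrt (u + harmonic n) @[n --> \oo] --> invsqrt u.
Proof.
have h0 n : 0 < @harmonic R n by rewrite /= invr_gt0.
have hc : u + harmonic n @[n --> \oo] --> u.
  by rewrite -[X in _ --> X]addr0; apply: cvgD; [exact: cvg_cst|exact: cvg_harmonic].
have sc : Num.sqrt (u + harmonic n) @[n --> \oo] --> Num.sqrt u.
  by apply: continuous_cvg hc; exact: sqrt_continuous.
rewrite le_eqVlt => /predU1P[u0|u0]; last first.
  rewrite invsqrt_gt0E//.
  under eq_fun do rewrite invsqrt_gt0E ?(addr_gt0 u0)//.
  apply: cvg_EFin; first by near=> n.
  by apply: cvgV => //; rewrite gt_eqF// sqrtr_gt0.
rewrite -u0 invsqrt0; rewrite -u0 sqrtr0 in sc; apply/cvgeyPge => A.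
have A1 : 0 < (`|A| + 1)^-1 by rewrite invr_gt0 ltr_wpDl.
near=> n; rewrite add0r invsqrt_gt0E// lee_fin.
apply: (@le_trans _ _ (`|A| + 1)).
  by rewrite (le_trans (ler_norm _))// lerDl.
rewrite -[leLHS]invrK lef_pV2 ?posrE ?sqrtr_gt0//.
rewrite -[leLHS]ger0_norm ?sqrtr_ge0//.
rewrite -[harmonic n]add0r -[X in `|X|]subr0 distrC.
near: n; exact: cvgr_dist_le sc _ A1.
Unshelve. all: by end_near. Qed.

Lemma measurable_inver : measurable_fun [set: R] (fun x => (x%:E)^-1)%E.
Proof.
under eq_fun do rewrite inver.
apply: measurable_fun_ifT => //.
- exact: measurable_fun_eqr.
- apply/measurable_EFinP; exact: measurable_invr.
Qed.

Lemma measurable_invsqrt : measurable_fun [set: R] invsqrt.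
Proof. exact: (measurableT_comp measurable_inver measurable_sqrt). Qed.

Lemma measurable_fun_invsqrt d (T : measurableType d) (f : T -> R) :
  measurable_fun setT f -> measurable_fun setT (fun z => invsqrt (f z)).
Proof. exact: measurableT_comp measurable_invsqrt. Qed.

End inverse_sqrt.

Section singular_kernel.
Context {R : realType}.
Notation TR := (measurableTypeR R).
Notation mu := (@lebesgue_measure R).
Notation mu2 := (mu \x mu)%E.

(** The domain of the polar coordinates of the displacements; a half turn is
    enough since each displacement is used with both signs. *)
Definition polar_rect (a : R) : set (TR * TR) := `[a, 1]%classic `*` `[0, pi]%classic.

Lemma measurable_polar_rect a : measurable (polar_rect a).
Proof. by apply: measurableX; exact: measurable_itv. Qed.

Variable a : R.
Hypotheses (a0 : 0 < a) (a1 : a <= 1).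

Lemma integral_inv_sqr (c : R) : 0 <= c ->
  (\int[mu2]_(z in polar_rect a) (z.1 ^- 2 * c)%:E = (c * pi * (a^-1 - 1))%:E)%E.
Proof.
move=> c0.
have mf : measurable_fun setT (fun z : TR * TR => (z.1 ^- 2 * c)%:E).
  by apply/measurable_EFinP; rewrite /=; measurability.
have f0 (z : TR * TR) : (0 <= (z.1 ^- 2 * c)%:E)%E.
  by rewrite lee_fin mulr_ge0// invr_ge0 sqr_ge0.
have mI : measurable (`[a, 1]%classic : set TR) by exact: measurable_itv.
have mJ : measurable (`[0, pi]%classic : set TR) by exact: measurable_itv.
rewrite /polar_rect (@tonelli_rectangle1 _ _ _ _ _ mu mu _ _ _ mf f0 mI mJ).
transitivity (\int[mu]_(r in `[a, 1%R]) (r ^- 2 * c * pi)%:E)%E.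
  apply: eq_integral => r _ /=; rewrite integral_cst//=.
  rewrite -(fineK (_ : mu `[0%R, pi] \is a fin_num)%E); last first.
    by rewrite ge0_fin_numE// itv_lty.
  by rewrite fine_itv ?pi_ge0// subr0 -EFinM.
have d (r : R) : a <= r <= 1 ->
    is_derive r 1 (fun r : R => - (c * pi) * r^-1) (r ^- 2 * c * pi).
  move=> /andP[ar _]; have r0 : r != 0 by rewrite gt_eqF// (lt_le_trans a0).
  have h := is_deriveM (is_derive_cst (- (c * pi)) r 1)
    (@is_deriveV _ (fun r => r) _ _ _ r0 (is_derive_id r 1)).
  have {}h : is_derive r 1 (fun r : R => - (c * pi) * r^-1) _ := h.
  by apply: (is_derive_eq h); rewrite /GRing.scale /=; ring.
have cn (r : R) : a <= r <= 1 -> {for r, continuous (fun r : R => r ^- 2 * c * pi)}.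
  move=> /andP[ar _]; have r0 : r != 0 by rewrite gt_eqF// (lt_le_trans a0).
  do 2 (apply: for_continuousM; last exact: for_continuous_cst).
  apply: for_continuousV; first by rewrite expf_neq0.
  by apply: for_continuousX; exact: for_continuous_id.
by rewrite (integral_ftc a1 d cn); congr EFin; rewrite invr1; ring.
Qed.

Variables (x y w l : R).
Hypothesis w0 : 0 <= w.
Let B := x ^+ 2 + y ^+ 2.
Let B0 : 0 <= B. Proof. by rewrite addr_ge0// sqr_ge0. Qed.

(** The squared distance of two bodies with relative position (x, y) in the
    plane, and w the sum of the squares of the remaining coordinates, after a
    displacement by k z.1 in the direction z.2. *)
Definition sqdist (k : R) (z : R * R) :=
  (x + k * z.1 * cos z.2) ^+ 2 + (y + k * z.1 * sin z.2) ^+ 2 + w.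

Lemma sqdist_ge0 k z : 0 <= sqdist k z.
Proof. by rewrite addr_ge0// addr_ge0// sqr_ge0. Qed.

Definition weighted_kernel (z : TR * TR) : \bar R :=
  ((z.1 ^- 2)%:E * (invsqrt (sqdist l z) + invsqrt (sqdist (- l) z)))%E.

Lemma measurable_sqdist k : measurable_fun [set: TR * TR] (sqdist k).
Proof. rewrite /sqdist; measurability. Qed.

(** The kernel regularised by replacing [w] by w + 1 / (n + 1). *)
Let app n (z : TR * TR) : \bar R :=
  ((z.1 ^- 2)%:E * (invsqrt (sqdist l z + harmonic n) +
                    invsqrt (sqdist (- l) z + harmonic n)))%E.

Let hn0 n : 0 < @harmonic R n. Proof. by rewrite /= invr_gt0. Qed.

Let measurable_app n : measurable_fun [set: TR * TR] (app n).
Proof.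
apply: emeasurable_funM; first by apply/measurable_EFinP; measurability.
by apply: emeasurable_funD; apply: measurable_fun_invsqrt;
  apply: measurable_funD => //; exact: measurable_sqdist.
Qed.

Let app_ge0 n z : (0 <= app n z)%E.
Proof.
by rewrite mule_ge0 ?lee_fin ?invr_ge0 ?sqr_ge0// adde_ge0// invsqrt_ge0.
Qed.

Let appE n z : app n z = (z.1 ^- 2 *
  ((sdist x y (w + harmonic n) l z.1 z.2)^-1 +
   (sdist x y (w + harmonic n) (- l) z.1 z.2)^-1))%:E.
Proof.
rewrite /app !invsqrt_gt0E ?ltr_wpDl ?sqdist_ge0// -EFinD -EFinM.
by rewrite /sdist /sqdist !addrA.
Qed.

Let int_app n : (\int[mu2]_(z in polar_rect a) app n z <=
  (2 * pi / a)%:E * invsqrt (B + w))%E.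
Proof.
have wn0 : 0 < w + harmonic n by rewrite ltr_wpDl.
apply: (@le_trans _ _ (2 * pi / (a * Num.sqrt (B + (w + harmonic n))))%:E).
  (* the divergence identity carries a factor B, so B = 0 is done apart: there
     each of the two distances is at least the square root of the regularised w *)
  have [B1|B1] := ltP 0 B; last first.
    have Beq : B = 0 by apply: le_anti; rewrite B0 B1.
    rewrite Beq add0r.
    have sw : 0 < Num.sqrt (w + harmonic n) by rewrite sqrtr_gt0.
    apply: (@le_trans _ _ (\int[mu2]_(z in polar_rect a)
      (z.1 ^- 2 * (2 / Num.sqrt (w + harmonic n)))%:E)%E).
      apply: ge0_le_integral.
      - exact: measurable_polar_rect.
      - by move=> z _; exact: app_ge0.
      - exact: measurable_funTS.
      - by apply/measurable_EFinP; apply: measurable_funTS; measurability.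
      - move=> z zr; rewrite appE lee_fin ler_wpM2l ?invr_ge0 ?sqr_ge0//.
        rewrite mulr_natl mulr2n.
        by apply: lerD; rewrite lef_pV2 ?posrE ?sdist_gt0// sdist_ge.
    have q0 : 0 <= 2 / Num.sqrt (w + harmonic n) by rewrite divr_ge0// ltW.
    rewrite integral_inv_sqr// lee_fin.
    rewrite (_ : 2 * pi / (a * Num.sqrt (w + harmonic n)) =
      2 / Num.sqrt (w + harmonic n) * pi * a^-1); last first.
      by field; rewrite !gt_eqF.
    by rewrite ler_wpM2l ?lerBlDr ?lerDl// mulr_ge0 ?pi_ge0.
  rewrite -(@lee_pmul2l _ B%:E) ?lte_fin// -EFinM.
  rewrite -(ge0_integralZl_EFin _ (measurable_polar_rect a)
    (fun z _ => app_ge0 n z) (measurable_funTS (measurable_app n)) B0).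
  have := kpot_integral_le x y l wn0 a0 a1.
  rewrite -/B => h.
  have -> : B * (2 * pi / (a * Num.sqrt (B + (w + harmonic n)))) =
    2 * B / (a * Num.sqrt (B + (w + harmonic n))) * pi by ring.
  apply: le_trans h.
  rewrite /polar_rect (@tonelli_rectangle1 _ _ _ _ _ mu mu
    (fun z => B%:E * app n z)%E).
  - rewrite le_eqVlt; apply/orP; left; apply/eqP.
    apply: eq_integral => r; rewrite inE /= in_itv /= => /andP[ar _].
    have r0 : 0 < r by rewrite (lt_le_trans a0).
    apply: eq_integral => th _; rewrite appE -EFinM /=; congr EFin.
    rewrite /kpot -/B; field.
    by rewrite !gt_eqF ?sdist_gt0.
  - exact: measurable_funeM.
  - by move=> z; rewrite mule_ge0.
  - exact: measurable_itv.
  - exact: measurable_itv.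
have bw : 0 <= B + w by rewrite addr_ge0.
apply: (@le_trans _ _ ((2 * pi / a)%:E * invsqrt (B + (w + harmonic n)))%E).
  rewrite invsqrt_gt0E ?ltr_wpDl// -EFinM lee_fin invfM mulrA.
  exact: lexx.
rewrite lee_wpmul2l// ?lee_fin ?divr_ge0 ?mulr_ge0 ?pi_ge0 ?(ltW a0)//.
by apply: le_invsqrt => //; rewrite addrA lerDl ltW.
Qed.

(** Monotone convergence from the regularised kernels, whose integrals are
    bounded by [kpot_integral_le]. *)
Lemma mean_kernel_le : (\int[mu2]_(z in polar_rect a) weighted_kernel z <=
  (2 * pi / a)%:E * invsqrt (B + w))%E.
Proof.
have cv : (\int[mu2]_(z in polar_rect a) app n z)%E @[n --> \oo] -->
    (\int[mu2]_(z in polar_rect a) weighted_kernel z)%E.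
  rewrite [X in _ --> X](_ : _ =
    (\int[mu2]_(z in polar_rect a) (fun u => limn (app ^~ u)) z)%E).
    apply: cvg_monotone_convergence.
    - exact: measurable_polar_rect.
    - by move=> n; exact: measurable_funTS.
    - by move=> n z _; exact: app_ge0.
    - move=> z zr m n mn; rewrite /app.
      rewrite lee_wpmul2l ?lee_fin ?invr_ge0 ?sqr_ge0//.
      have hmn : @harmonic R n <= @harmonic R m.
        by rewrite /= lef_pV2 ?posrE// ler_nat.
      by apply: leeD; apply: le_invsqrt; rewrite ?lerD2l//
        addr_ge0 ?sqdist_ge0// ltW.
  apply: eq_integral => z _; apply/esym/cvg_lim => //.
  apply: cvgeZl => //; apply: cvgeD; last 2 first.
  - exact: invsqrt_cvg (sqdist_ge0 l z).
  - exact: invsqrt_cvg (sqdist_ge0 (- l) z).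
  - by rewrite ge0_adde_def// inE invsqrt_ge0.
rewrite -(cvg_lim _ cv)//; apply: lime_le; first by apply/cvg_ex; eexists; exact: cv.
by near=> n; exact: int_app.
Unshelve. all: by end_near. Qed.

End singular_kernel.

Section kernel_gain.
Context {R : realType}.
Notation TR := (measurableTypeR R).
Notation mu := (@lebesgue_measure R).
Notation mu2 := (mu \x mu)%E.
Variables (a x y w l l0 : R).
Hypotheses (a0 : 0 < a) (a1 : a <= 1) (w0 : 0 <= w).
Hypotheses (l0_gt0 : 0 < l0) (l0l : l0 <= `|l|).

Let weighted_kernel_ge0 z : (0 <= weighted_kernel x y w l z)%E.
Proof.
by rewrite mule_ge0 ?lee_fin ?invr_ge0 ?sqr_ge0// adde_ge0// invsqrt_ge0.
Qed.

Lemma measurable_weighted_kernel :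
  measurable_fun [set: TR * TR] (weighted_kernel x y w l).
Proof.
apply: emeasurable_funM; first by apply/measurable_EFinP; measurability.
by apply: emeasurable_funD; apply: measurable_fun_invsqrt;
  exact: measurable_sqdist.
Qed.

(** The triangle inequality in space. *)
Lemma sqdist_ge (k r th : R) : `|k| = `|l| -> 0 <= r ->
  (`|l| * r - Num.sqrt (x ^+ 2 + y ^+ 2 + w)) ^+ 2 <= sqdist x y w k (r, th).
Proof.
move=> kl r0; rewrite /sqdist /=.
have N0 : 0 <= x ^+ 2 + y ^+ 2 + w by rewrite !addr_ge0 ?sqr_ge0.
have N2 := sqr_sqrtr N0; have := sqrtr_ge0 (x ^+ 2 + y ^+ 2 + w).
move: N2; set N := Num.sqrt _ => N2 Ng0.
have k2 : `|l| ^+ 2 = k ^+ 2 by rewrite -kl real_normK// num_real.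
have ab := @along2_across2 R x y th.
have pN : `|along x y th| <= N.
  rewrite -ler_sqr ?nnegrE// real_normK ?num_real// N2 -ab.
  by rewrite -addrA lerDl addr_ge0 ?sqr_ge0.
have kp : - (`|l| * r * N) <= k * r * along x y th.
  have : `|k * r * along x y th| <= `|l| * r * N.
    by rewrite normrM normrM kl (ger0_norm r0) ler_wpM2l// mulr_ge0.
  by rewrite ler_norml => /andP[].
have -> : (x + k * r * cos th) ^+ 2 + (y + k * r * sin th) ^+ 2 + w =
    N ^+ 2 + 2 * (k * r * along x y th) + k ^+ 2 * r ^+ 2.
  rewrite N2 /along; apply/eqP; rewrite -subr_eq0.
  rewrite (_ : _ - _ = k ^+ 2 * r ^+ 2 * (cos th ^+ 2 + sin th ^+ 2 - 1)).
    by rewrite cos2Dsin2 subrr mulr0.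
  by ring.
by rewrite sqrrB exprMn k2 -mulr_natl; lra.
Qed.

(** Every displacement has length at least l0 a, so the bodies end up at a
    distance at least l0 a - l0 a / 4 >= l0 a / 2, and the left integral is at
    most 4 pi / (l0 a^2); the right-hand side is at least twice that. *)
Lemma mean_kernel_gain : Num.sqrt (x ^+ 2 + y ^+ 2 + w) <= l0 * a / 4 ->
  (\int[mu2]_(z in polar_rect a) weighted_kernel x y w l z +
   (4 * pi / (l0 * a ^+ 2))%:E <=
   (2 * pi / a)%:E * invsqrt (x ^+ 2 + y ^+ 2 + w))%E.
Proof.
move=> Nle; have la0 : 0 < l0 * a by rewrite mulr_gt0.
have c0 : 0 <= 4 / (l0 * a) by rewrite divr_ge0// ltW.
have bound : (\int[mu2]_(z in polar_rect a) weighted_kernel x y w l z <=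
    (4 * pi / (l0 * a ^+ 2))%:E)%E.
  apply: (@le_trans _ _ (\int[mu2]_(z in polar_rect a)
    (z.1 ^- 2 * (4 / (l0 * a)))%:E)%E).
    apply: ge0_le_integral.
    - exact: measurable_polar_rect.
    - by move=> z _; exact: weighted_kernel_ge0.
    - by apply: measurable_funTS; exact: measurable_weighted_kernel.
    - by apply/measurable_EFinP; apply: measurable_funTS; measurability.
    - move=> [r th] [/= + _]; rewrite in_itv /= => /andP[ar _].
      have r0 : 0 < r by rewrite (lt_le_trans a0).
      have h k : `|k| = `|l| ->
          (invsqrt (sqdist x y w k (r, th)) <= (2 / (l0 * a))%:E)%E.
        move=> kl; have sq := sqdist_ge th kl (ltW r0).
        have lr : l0 * a / 2 <= `|l| * r - Num.sqrt (x ^+ 2 + y ^+ 2 + w).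
          have : l0 * a <= `|l| * r by apply: ler_pM => //; exact: ltW.
          by lra.
        have d0 : 0 < l0 * a / 2 by rewrite divr_gt0.
        have h2 : (l0 * a / 2) ^+ 2 <= sqdist x y w k (r, th).
          apply: le_trans sq; rewrite ler_sqr// nnegrE.
            exact: ltW.
          exact: le_trans (ltW d0) lr.
        apply: (le_trans (le_invsqrt (sqr_ge0 _) h2)).
        rewrite invsqrt_gt0E ?exprn_gt0// lee_fin sqrtr_sqr gtr0_norm//.
        by rewrite invf_div.
      rewrite /weighted_kernel EFinM lee_wpmul2l ?lee_fin ?invr_ge0 ?sqr_ge0//.
      have -> : 4 / (l0 * a) = 2 / (l0 * a) + 2 / (l0 * a) by lra.
      by rewrite EFinD; apply: leeD; apply: h; rewrite ?normrN.
  rewrite integral_inv_sqr// lee_fin.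
  rewrite (_ : 4 * pi / (l0 * a ^+ 2) = 4 / (l0 * a) * pi * a^-1); last first.
    by field; rewrite !gt_eqF.
  by rewrite ler_wpM2l ?lerBlDr ?lerDl// mulr_ge0 ?pi_ge0.
apply: (le_trans (leeD bound (lexx _))).
apply: (@le_trans _ _ ((2 * pi / a)%:E * (4 / (l0 * a))%:E)%E).
  rewrite -EFinD -EFinM lee_fin le_eqVlt; apply/orP; left; apply/eqP.
  by field; rewrite !gt_eqF.
rewrite lee_wpmul2l ?lee_fin ?divr_ge0 ?mulr_ge0 ?pi_ge0 ?(ltW a0)//.
have q0 : 0 < (l0 * a / 4) by rewrite divr_gt0.
apply: (@le_trans _ _ (invsqrt ((l0 * a / 4) ^+ 2))).
  by rewrite invsqrt_gt0E ?exprn_gt0// lee_fin sqrtr_sqr gtr0_norm// invf_div.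
apply: le_invsqrt; first by rewrite !addr_ge0 ?sqr_ge0.
rewrite -[leLHS]sqr_sqrtr ?ler_sqr ?nnegrE ?sqrtr_ge0// ?(ltW q0)//.
by rewrite !addr_ge0 ?sqr_ge0.
Qed.

End kernel_gain.

(** * The action in terms of weak derivatives *)
Section ae_integral.
Local Open Scope ereal_scope.
Context d (T : measurableType d) (R : realType).
Variables (mu : {measure set T -> \bar R}) (D : set T).
Import HBNNSimple.

Let le_ae (f g : T -> \bar R) : (forall t, 0 <= f t) -> (forall t, 0 <= g t) ->
  {ae mu, forall t, f t <= g t} -> \int[mu]_t f t <= \int[mu]_t g t.
Proof.
move=> f0 g0 [N [mN muN fgN]].
rewrite [leLHS]ge0_integralTE// [leRHS]ge0_integralTE//.
apply: ge_ereal_sup => _ [h /= hf <-].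
pose h' := proj_nnsfun h (measurableC mN).
have h'E t : h' t = (h t * \1_(~` N) t)%R by [].
have -> : sintegral mu h = sintegral mu h'.
  have -> : sintegral mu h = \int[mu]_t (h t)%:E.
    by rewrite (integral_nnsfun mu measurableT h) patch_setT.
  have -> : sintegral mu h' = \int[mu]_t (h' t)%:E.
    by rewrite (integral_nnsfun mu measurableT h') patch_setT.
  apply: ge0_ae_eq_integral => //.
  - exact/measurable_EFinP.
  - exact/measurable_EFinP.
  - by move=> t _; rewrite lee_fin.
  - by move=> t _; rewrite lee_fin.
  - exists N; split => // t /= ht; apply: contrapT => Nt; apply: ht => _.
    by rewrite -[RHS]/((h' t)%:E) h'E indicE mem_set ?mulr1.
apply: ereal_sup_ubound; exists h' => // t.
rewrite -/(h' t) h'E indicE; have [tN|tN] := pselect (N t).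
  by rewrite memNset ?mulr0//=; move=> /(_ tN).
rewrite mem_set ?mulr1//; apply: le_trans (hf t) _.
by apply: contrapT => /negP ft; apply: tN; apply: fgN => /= fg; rewrite fg in ft.
Qed.

(** The integral of a nonnegative function is a supremum over the simple
    functions below it, and cutting one of these to the complement of a null
    set does not change its integral. This is applied to the integrand of
    the action, whose pointwise derivative takes arbitrary values on a null
    set. *)
Lemma ge0_ae_eq_integral_gen (f g : T -> \bar R) :
  (forall t, 0 <= f t) -> (forall t, 0 <= g t) ->
  {ae mu, forall t, D t -> f t = g t} ->
  \int[mu]_(t in D) f t = \int[mu]_(t in D) g t.
Proof.
move=> f0 g0 fg; rewrite integral_mkcond [RHS]integral_mkcond.
by apply/eqP; rewrite eq_le; apply/andP; split; apply: le_ae;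
  do ?[by move=> t; rewrite patchE; case: ifP]; move: fg;
  apply: filterS => t /= fgt;
  rewrite !patchE; case: ifPn => // tD; rewrite fgt//; exact: set_mem.
Qed.

End ae_integral.

Section derive_row.
Context {R : realType} (d : nat).

Lemma derive1_row (f : R -> 'rV[R]_d) (t : R) (v : 'I_d -> R) :
  (forall k, is_derive t 1 (fun s => f s 0 k) (v k)) ->
  derive1 f t = \row_k v k.
Proof.
move=> df; have dft : derivable f t 1.
  apply/derivable_mxP => i j; rewrite (ord1 i).
  exact: ex_derive.
rewrite derive1E derive_mx//; apply/rowP => k; rewrite !mxE.
exact: derive_val.
Qed.

End derive_row.

Section action.
Context {R : realType} (d n : nat).
Notation mu := (@lebesgue_measure R).
Notation TR := (measurableTypeR R).
Implicit Types (x : R -> configuration R d n) (v : 'I_n -> 'I_d -> R -> R).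

Definition velocities x v :=
  forall i k, weak_derivative (fun t => x t i 0 k) (v i k).

Definition kinetic (m : R) v (t : R) : R :=
  2^-1 * \sum_(i < n) m * \sum_(k < d) v i k t ^+ 2.

Definition sqnorm (u : 'rV[R]_d) : R := \sum_(k < d) u 0 k ^+ 2.

Definition pairs : seq ('I_n * 'I_n) :=
  [seq p : 'I_n * 'I_n <- enum {: 'I_n * 'I_n} | (p.1 < p.2)%N].

Definition potential (m : R) (c : configuration R d n) : \bar R :=
  (\sum_(p <- pairs) (m ^+ 2)%R%:E * invsqrt (sqnorm (c p.1 - c p.2)))%E.

Lemma potentialE m c : potential m c = (\sum_(i < n) \sum_(j < n | (i < j)%N)
  (m ^+ 2)%R%:E / (enorm (c i - c j))%:E)%E.
Proof.
rewrite pair_big_dep /= /potential /pairs big_filter big_enum_cond /=.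
by apply: eq_bigl => p.
Qed.

Lemma kinetic_ge0 m v t : 0 <= m -> 0 <= kinetic m v t.
Proof.
move=> m0; rewrite mulr_ge0 ?invr_ge0//; apply: sumr_ge0 => i _.
by rewrite mulr_ge0//; apply: sumr_ge0 => k _; exact: sqr_ge0.
Qed.

Lemma potential_ge0 m c : (0 <= potential m c)%E.
Proof.
apply: sume_ge0 => p _.
by rewrite mule_ge0 ?invsqrt_ge0// lee_fin sqr_ge0.
Qed.

Lemma velocities_exist x : (forall i k, H1loc (fun t => x t i 0 k)) ->
  exists v, velocities x v.
Proof.
move=> hx.
by exists (fun i k => projT1 (cid (hx i k))) => i k; exact: projT2 (cid (hx i k)).
Qed.

Lemma measurable_kinetic m x v : velocities x v ->
  measurable_fun [set: TR] (kinetic m v).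
Proof.
move=> xv; apply: measurable_funM => //; apply: measurable_sum => i.
apply: measurable_funM => //; apply: measurable_sum => k.
by apply: measurable_funX; have [] := xv i k.
Qed.

Lemma measurable_potential d' (S : measurableType d') m
    (y : S -> configuration R d n) :
  (forall i k, measurable_fun setT (fun s => y s i 0 k)) ->
  measurable_fun setT (fun s => potential m (y s)).
Proof.
move=> my; apply: emeasurable_sum => p.
apply: measurable_funeM; apply: measurable_fun_invsqrt.
apply: measurable_sum => k; apply: measurable_funX.
under eq_fun do rewrite !mxE.
exact: measurable_funB.
Qed.

Lemma velocities_measurable x v i k : velocities x v ->
  measurable_fun [set: TR] (fun t => x t i 0 k).
Proof.
move=> xv; apply: continuous_measurable_fun.
exact: weak_derivative_continuous (xv i k).
Qed.

(** The pointwise derivative is almost everywhere the weak one, and the kinetic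
    and potential parts may then be integrated separately. *)
Lemma actionE m T x v : 0 <= m -> velocities x v ->
  action m T x = (\int[mu]_(t in `[0%R, T]) (kinetic m v t)%:E +
                  \int[mu]_(t in `[0%R, T]) potential m (x t))%E.
Proof.
move=> m0 xv; rewrite -ge0_integralD//=; last 4 first.
- by move=> t _; rewrite lee_fin kinetic_ge0.
- by apply/measurable_EFinP; apply: measurable_funTS; exact: measurable_kinetic xv.
- by move=> t _; exact: potential_ge0.
- apply: measurable_funTS; apply: measurable_potential => i k.
  exact: velocities_measurable xv.
apply: ge0_ae_eq_integral_gen.
- move=> t; rewrite -potentialE adde_ge0 ?potential_ge0// lee_fin.
  rewrite mulr_ge0 ?invr_ge0//; apply: sumr_ge0 => i _.
  by rewrite mulr_ge0// sqr_ge0.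
- by move=> t; rewrite adde_ge0 ?potential_ge0// lee_fin kinetic_ge0.
have : {ae mu, forall t : R, forall (i : 'I_n) (k : 'I_d), 0 <= t ->
    is_derive t 1 (fun t : R => x t i 0 k) (v i k t)}.
  apply: filter_forall => i; apply: filter_forall => k.
  exact: weak_derivative_ae (xv i k).
apply: filterS; first exact: (ae_filter_ringOfSetsType mu).
move=> t ht; rewrite /= in_itv /= => /andP[t0 _].
rewrite -potentialE; congr (_ + _)%E; congr (_%:E); congr (_ * _); apply: eq_bigr => i _.
congr (_ * _); rewrite (derive1_row (fun k => ht i k t0)) /enorm.
rewrite sqr_sqrtr; last by apply: sumr_ge0 => k _; exact: sqr_ge0.
by apply: eq_bigr => k _; rewrite mxE.
Qed.

End action.

(** * The perturbed choreographies *)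

(** After multiplication by 2 sin (pi / n) the sum telescopes. *)
Lemma sum_cos_roots {R : realType} (n : nat) (al : R) : (2 <= n)%N ->
  \sum_(i < n) cos (al + 2 * pi / n%:R * i%:R) = 0.
Proof.
move=> n2; have n0 : 0 < n%:R :> R by rewrite ltr0n (leq_trans _ n2).
pose h : R := pi / n%:R.
have sh : 0 < sin h.
  apply: sin_gt0_pi; rewrite /h divr_gt0 ?pi_gt0//=.
  by rewrite ltr_pdivrMr// ltr_pMr ?pi_gt0// ltr1n.
pose f (i : nat) := sin (al + 2 * h * i%:R - h).
have fE (i : nat) : 2 * sin h * cos (al + 2 * pi / n%:R * i%:R) = f i.+1 - f i.
  have -> : al + 2 * pi / n%:R * i%:R = al + 2 * h * i%:R by rewrite /h; ring.
  rewrite /f -(natr1 i).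
  have -> : al + 2 * h * (i%:R + 1) - h = (al + 2 * h * i%:R) + h by ring.
  by rewrite sinD sinB; ring.
apply: (@mulfI _ (2 * sin h)); first by rewrite mulf_neq0// gt_eqF.
rewrite mulr0 mulr_sumr (eq_bigr (fun i : 'I_n => f i.+1 - f i)); last first.
  by move=> i _; exact: fE.
rewrite -(big_mkord xpredT (fun i => f i.+1 - f i)) telescope_sumr//.
rewrite /f mulr0 addr0.
have -> : al + 2 * h * n%:R - h = (al - h) + pi *+ 2.
  by rewrite /h -mulr_natl; field; rewrite gt_eqF.
by rewrite sinD2pi subrr.
Qed.

Lemma sin_eq0_half {R : realType} (A : R) : cos (A + A) = 1 -> sin A = 0.
Proof.
rewrite cosD -!expr2 => h; have := cos2Dsin2 A => h2.
by apply/eqP; rewrite -sqrf_eq0; apply/eqP; lra.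
Qed.

Section competitor.
Context {R : realType} (e n : nat).
Notation d := e.+2.
Variables (T t0 : R) (k : 'I_n).
Hypotheses (T0 : 0 < T) (n2 : (2 <= n)%N).
Implicit Types (x : R -> configuration R d n) (v : 'I_n -> 'I_d -> R -> R).

Let n0 : 0 < n%:R :> R. Proof. by rewrite ltr0n (leq_trans _ n2). Qed.

(** Body [k] has phase 0 at [t0], and the bodies are equally spaced in phase. *)
Definition phase (i : nat) (t : R) : R :=
  2 * pi / T * (t - t0) + 2 * pi / n%:R * (i%:R - k%:R).
Definition wave i t : R := cos (phase i t).
Definition dwave i t : R := - (2 * pi / T * sin (phase i t)).

Definition dirv (th : R) : 'rV[R]_d :=
  \row_(j < d) (if j == 0%N :> nat then cos th
                else if j == 1%N :> nat then sin th else 0).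

Definition perturb x (c th : R) : R -> configuration R d n :=
  fun t i => x t i + (c * wave i t) *: dirv th.

Lemma sum_wave t : \sum_(i < n) wave i t = 0.
Proof.
rewrite -[RHS](sum_cos_roots (2 * pi / T * (t - t0) - 2 * pi / n%:R * k%:R) n2).
by apply: eq_bigr => i _; rewrite /wave /phase; congr cos; ring.
Qed.

Lemma waveT i t : wave i (t + T) = wave i t.
Proof.
rewrite /wave -[in RHS]cosD2pi; congr cos; rewrite /phase -mulr_natl.
by field; rewrite !gt_eqF.
Qed.

Lemma wave_ordS (i : 'I_n) t : wave (ordS i) t = wave i (t + T / n%:R).
Proof.
rewrite /wave /= /phase; have := ltn_ord i; rewrite leq_eqVlt => /predU1P[iE|lt].
  rewrite iE modnn -[in LHS]cosD2pi; congr cos.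
  have -> : n%:R = i%:R + 1 :> R by rewrite natr1 iE.
  rewrite -mulr_natl; field.
  by rewrite natr1 iE !gt_eqF.
rewrite modn_small// -(natr1 i); congr cos; field.
by rewrite !gt_eqF.
Qed.

(** Body [k] is at the maximum of the wave at [t0], and two distinct bodies have
    distinct phases modulo 2 pi. *)
Lemma wave_t0 (j : 'I_n) : j != k -> wave j t0 < wave k t0.
Proof.
move=> jk; rewrite /wave /phase !subrr mulr0 !add0r mulr0 cos0.
rewrite lt_neqAle cos_le1 andbT; apply/negP => /eqP c1.
have s0 : sin (pi / n%:R * (j%:R - k%:R)) = 0 :> R.
  by apply: sin_eq0_half; rewrite -[RHS]c1; congr cos; ring.
have key (p q : 'I_n) : (p < q)%N -> sin (pi / n%:R * (q%:R - p%:R)) != 0 :> R.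
  move=> pq; rewrite gt_eqF// sin_gt0_pi//.
  have qp : 0 < q%:R - p%:R :> R by rewrite subr_gt0 ltr_nat.
  rewrite mulr_gt0 ?divr_gt0 ?pi_gt0//=.
  rewrite mulrAC ltr_pdivrMr// ltr_pM2l ?pi_gt0//.
  by rewrite ltrBlDr (lt_le_trans (_ : q%:R < n%:R)) ?ltr_nat// lerDl.
move: jk; rewrite neq_ltn => /orP[jk|kj].
  have /eqP := key _ _ jk; apply.
  by rewrite -opprB mulrN sinN s0 oppr0.
by have /eqP := key _ _ kj; apply.
Qed.

Let continuous_phase i (t : R) : {for t, continuous (phase i)}.
Proof.
apply: (@for_continuousD _ _ (fun t => 2 * pi / T * (t - t0))); last first.
  exact: for_continuous_cst.
apply: for_continuousM; first exact: for_continuous_cst.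
by apply: for_continuousD; [exact: for_continuous_id|exact: for_continuous_cst].
Qed.

Lemma continuous_wave i : continuous (wave i).
Proof.
move=> t; apply: (@continuous_comp _ _ _ (phase i) cos).
  exact: continuous_phase.
exact: continuous_cos.
Qed.

Lemma continuous_dwave i : continuous (dwave i).
Proof.
move=> t.
apply: (@for_continuousN _ _ (fun t => 2 * pi / T * sin (phase i t))).
apply: for_continuousM; first exact: for_continuous_cst.
apply: (@continuous_comp _ _ _ (phase i) sin); first exact: continuous_phase.
exact: continuous_sin.
Qed.

Lemma is_derive_wave i (t : R) : is_derive t 1 (wave i) (dwave i t).
Proof.
have dp : is_derive t 1 (phase i) (2 * pi / T).
  rewrite /phase; apply: is_derive_eq.
  by rewrite /GRing.scale /=; ring.
have h : is_derive t 1 (wave i) _ := is_derive1_comp (is_derive_cos _) dp.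
by apply: (is_derive_eq h); rewrite /dwave; ring.
Qed.

Definition perturbv v (c th : R) : 'I_n -> 'I_d -> R -> R :=
  fun i j t => v i j t + c * dwave i t * dirv th 0 j.

Lemma velocities_perturb x v c th : velocities x v ->
  velocities (perturb x c th) (perturbv v c th).
Proof.
move=> xv i j.
have -> : (fun t => perturb x c th t i 0 j) =
  (fun t => x t i 0 j + c * wave i t * dirv th 0 j).
  by apply/funext => t; rewrite /perturb !mxE.
apply: weak_derivativeD; first exact: xv.
  move=> t; have h := is_deriveM (is_deriveM (is_derive_cst c t 1)
    (is_derive_wave i t)) (is_derive_cst (dirv th 0 j) t 1).
  have {}h : is_derive t 1 (fun t : R => c * wave i t * dirv th 0 j) _ := h.
  by apply: (is_derive_eq h); rewrite /GRing.scale /=; ring.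
move=> t; apply: (@for_continuousM _ _ (fun t => c * dwave i t)).
  apply: for_continuousM; first exact: for_continuous_cst.
  exact: continuous_dwave.
exact: for_continuous_cst.
Qed.

Lemma choreography_perturb x c th :
  choreography T x -> choreography T (perturb x c th).
Proof.
move=> [[cx px hx] sx]; split; last first.
  by move=> t i; rewrite /perturb sx wave_ordS.
split.
- move=> t; rewrite /centered /perturb big_split /= cx add0r -scaler_suml.
  by rewrite -mulr_sumr sum_wave mulr0 scale0r.
- by move=> i t; rewrite /perturb waveT; congr (_ + _); exact: px.
- have [v xv] := velocities_exist hx.
  by move=> i j; exists (perturbv v c th i j); exact: velocities_perturb.
Qed.

Lemma sum_dirv2 th : \sum_(j < d) dirv th 0 j ^+ 2 = 1.
Proof.
rewrite !big_ord_recl /= big1 => [|j _]; last by rewrite mxE /= expr0n.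
by rewrite !mxE /= addr0 cos2Dsin2.
Qed.

Lemma dwave_bound i t : dwave i t ^+ 2 <= (2 * pi / T) ^+ 2.
Proof.
by rewrite /dwave sqrrN exprMn ler_piMr ?sqr_ge0.
Qed.

(** The parallelogram identity: the cross terms of the two competitors are
    opposite. *)
Lemma kinetic_parallelogram m v c th t : 0 <= m ->
  kinetic m (perturbv v c th) t + kinetic m (perturbv v (- c) th) t <=
  2 * kinetic m v t + m * n%:R * (2 * pi / T) ^+ 2 * c ^+ 2.
Proof.
move=> m0; rewrite /kinetic -mulrDr -big_split /=.
apply: (@le_trans _ _ (2^-1 * \sum_(i < n) (2 * (m * \sum_(j < d) v i j t ^+ 2)
   + 2 * (m * (c ^+ 2 * (2 * pi / T) ^+ 2))))); last first.
  rewrite big_split /= -mulr_sumr sumr_const card_ord -[X in _ + X]mulr_natl.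
  rewrite le_eqVlt; apply/orP; left; apply/eqP; field.
  by rewrite gt_eqF.
rewrite ler_wpM2l ?invr_ge0//; apply: ler_sum => i _.
rewrite -mulrDr mulrCA [2 * (m * _)]mulrCA -mulrDr ler_wpM2l//.
rewrite -big_split /=.
have -> : \sum_(j < d) (perturbv v c th i j t ^+ 2 +
    perturbv v (- c) th i j t ^+ 2) =
  \sum_(j < d) (2 * v i j t ^+ 2 + 2 * (c ^+ 2 * dwave i t ^+ 2) *
    dirv th 0 j ^+ 2).
  by apply: eq_bigr => j _; rewrite /perturbv; ring.
rewrite big_split /= -!mulr_sumr sum_dirv2 mulr1 lerD2l ler_wpM2l//.
by rewrite ler_wpM2l ?sqr_ge0// dwave_bound.
Qed.

(** The part of the squared norm that perturbations in the plane of the first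
    two coordinates do not change. *)
Definition tail2 (u : 'rV[R]_d) : R :=
  \sum_(j < e) u 0 (lift ord0 (lift ord0 j)) ^+ 2.

Lemma tail2_ge0 u : 0 <= tail2 u.
Proof. by apply: sumr_ge0 => j _; exact: sqr_ge0. Qed.

Lemma sqnorm_split u :
  sqnorm u = u 0 ord0 ^+ 2 + u 0 (lift ord0 ord0) ^+ 2 + tail2 u.
Proof. by rewrite /sqnorm !big_ord_recl addrA. Qed.

Lemma sqnorm_dirv u (l r th : R) : sqnorm (u + (l * r) *: dirv th) =
  sqdist (u 0 ord0) (u 0 (lift ord0 ord0)) (tail2 u) l (r, th).
Proof.
rewrite sqnorm_split /sqdist !mxE /=; congr (_ + _ + _).
by apply: eq_bigr => j _; rewrite !mxE /= mulr0 addr0.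
Qed.

Lemma perturbB x c th t i j : perturb x c th t i - perturb x c th t j =
  (x t i - x t j) + ((wave i t - wave j t) * c) *: dirv th.
Proof. by rewrite /perturb mulrBl scalerBl opprD !(mulrC c) addrACA. Qed.

(** The contribution of a pair of bodies to the weighted potential of the two
    competitors. *)
Definition pair_kernel x t (p : 'I_n * 'I_n) (z : R * R) : \bar R :=
  let u := x t p.1 - x t p.2 in
  weighted_kernel (u 0 ord0) (u 0 (lift ord0 ord0)) (tail2 u)
    (wave p.1 t - wave p.2 t) z.

Lemma potential_perturb m x t (r th : R) :
  ((r ^- 2)%:E * (potential m (perturb x r th t) +
                  potential m (perturb x (- r) th t)))%E =
  (\sum_(p <- pairs n) (m ^+ 2)%:E * pair_kernel x t p (r, th))%E.
Proof.
rewrite /potential -big_split /= ge0_sume_distrr; last first.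
  by move=> p _; rewrite adde_ge0// mule_ge0 ?invsqrt_ge0// lee_fin sqr_ge0.
apply: eq_bigr => p _; rewrite /pair_kernel /weighted_kernel /= !perturbB.
rewrite mulrN -mulNr !sqnorm_dirv -ge0_muleDr ?invsqrt_ge0//.
by rewrite muleCA.
Qed.

End competitor.

(** * Averaging the minimality over the perturbations *)
Section averaging.
Context {R : realType} (e n : nat).
Notation d := e.+2.
Notation TR := (measurableTypeR R).
Notation mu := (@lebesgue_measure R).
Notation mu2 := (mu \x mu)%E.
Variables (T t0 m : R) (k : 'I_n) (x : R -> configuration R d n).
Hypotheses (T0 : 0 < T) (n2 : (2 <= n)%N) (m0 : 0 < m).
Hypothesis xmin : minimizer m T x.

Local Notation J := (`[0%R, T]%classic : set TR).
Let mJ : measurable J. Proof. exact: measurable_itv. Qed.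

Definition kinetic_cost : R := m * n%:R * (2 * pi / T) ^+ 2 * T.

Let cost_ge0 : 0 <= kinetic_cost.
Proof.
apply: mulr_ge0; last exact: ltW.
by apply: mulr_ge0; rewrite ?sqr_ge0// mulr_ge0// ltW.
Qed.

Definition total_potential : \bar R := (\int[mu]_(t in J) potential m (x t))%E.

Local Notation pert := (perturb T t0 k x).

Let xv : exists v, velocities x v.
Proof. by have [[[_ _ hx] _] _ _] := xmin; exact: velocities_exist. Qed.

Lemma measurable_pert : forall i j,
  measurable_fun [set: TR * (TR * TR)]
    (fun s => pert s.2.1 s.2.2 s.1 i 0 j).
Proof.
move=> i j; have [v hv] := xv.
have m1 : measurable_fun [set: TR * (TR * TR)] (fun s => x s.1 i 0 j).
  exact: (measurableT_comp (velocities_measurable i j hv) measurable_fst).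
have m2 : measurable_fun [set: TR * (TR * TR)] (fun s => s.2.1).
  exact: (measurableT_comp measurable_fst measurable_snd).
have m3 : measurable_fun [set: TR * (TR * TR)] (fun s => s.2.2).
  exact: (measurableT_comp measurable_snd measurable_snd).
have m4 : measurable_fun [set: TR * (TR * TR)]
    (fun s => wave T t0 k i s.1).
  apply: (measurableT_comp _ measurable_fst).
  by apply: continuous_measurable_fun; exact: continuous_wave.
have m5 : measurable_fun [set: TR * (TR * TR)] (fun s => dirv e s.2.2 0 j).
  under eq_fun do rewrite mxE.
  case: (j == 0%N :> nat); first exact: measurable_fun_cos.
  case: (j == 1%N :> nat); first exact: measurable_fun_sin.
  exact: measurable_cst.
have -> : (fun s => pert s.2.1 s.2.2 s.1 i 0 j) = (fun s : TR * (TR * TR) =>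
    x s.1 i 0 j + s.2.1 * wave T t0 k i s.1 * dirv e s.2.2 0 j).
  by apply/funext => s; rewrite /perturb [LHS]mxE; congr (_ + _); rewrite mxE.
by apply: measurable_funD => //; apply: measurable_funM => //; exact: measurable_funM.
Qed.

Let measurable_pertN : forall i j,
  measurable_fun [set: TR * (TR * TR)]
    (fun s => pert (- s.2.1) s.2.2 s.1 i 0 j).
Proof.
move=> i j.
have mg : measurable_fun [set: TR * (TR * TR)]
    (fun s => (s.1, (- s.2.1, s.2.2)) : TR * (TR * TR)).
  apply: measurable_fun_pair; first exact: measurable_fst.
  apply: measurable_fun_pair; last first.
    exact: (measurableT_comp measurable_snd measurable_snd).
  apply: measurable_funN.
  exact: (measurableT_comp measurable_fst measurable_snd).
exact: (measurableT_comp (measurable_pert i j) mg).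
Qed.

(** The potential of the two competitors for the displacement with polar
    coordinates s.2, at time s.1. *)
Definition weighted_potential (s : R * (R * R)) : \bar R :=
  ((s.2.1 ^- 2)%:E * (potential m (pert s.2.1 s.2.2 s.1) +
                      potential m (pert (- s.2.1) s.2.2 s.1)))%E.

Lemma weighted_potential_ge0 s : (0 <= weighted_potential s)%E.
Proof.
by rewrite mule_ge0 ?lee_fin ?invr_ge0 ?sqr_ge0// adde_ge0// potential_ge0.
Qed.

Lemma measurable_weighted_potential :
  measurable_fun [set: TR * (TR * TR)] weighted_potential.
Proof.
apply: emeasurable_funM.
  apply/measurable_EFinP; apply: measurable_funV; apply: measurable_funX.
  exact: (measurableT_comp measurable_fst measurable_snd).
apply: emeasurable_funD; apply: measurable_potential.
  exact: measurable_pert.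
exact: measurable_pertN.
Qed.

Let measurable_pert_t c th :
  measurable_fun [set: TR] (fun t => potential m (pert c th t)).
Proof.
apply: measurable_potential => i j.
have mg : measurable_fun [set: TR] (fun t => (t, (c, th)) : TR * (TR * TR)).
  by apply: measurable_fun_pair => //; exact: measurable_fun_pair.
exact: (measurableT_comp (measurable_pert i j) mg).
Qed.

Lemma total_potential_lty : (total_potential < +oo)%E.
Proof.
have [v hv] := xv; have [_ + _] := xmin.
rewrite (actionE T (ltW m0) hv); apply: le_lt_trans.
by apply: leeDr; apply: integral_ge0 => t _; rewrite lee_fin kinetic_ge0// ltW.
Qed.

Let cancel_kinetic (K X c : R) (P : \bar R) :
  ((K + K + (X + X))%:E <= (2 * K + c)%:E + P -> (2 * X)%:E <= c%:E + P)%E.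
Proof.
case: P => [p| |].
- by rewrite -!EFinD !lee_fin; lra.
- by rewrite !addey// !leey.
- by rewrite !addeNy.
Qed.

(** Minimality against both competitors; the kinetic action of x is finite and
    cancels. *)
Lemma competitors_le (r th : R) : (2%:E * total_potential <=
  (kinetic_cost * r ^+ 2)%:E + \int[mu]_(t in J)
    (potential m (pert r th t) + potential m (pert (- r) th t)))%E.
Proof.
have [v hv] := xv; have [cx fx mx] := xmin; have m0' := ltW m0.
have hp c := velocities_perturb T t0 k c th hv.
have hc c := mx _ (choreography_perturb t0 k T0 n2 c th cx).
have kin0 w t : (0 <= (kinetic m w t)%:E :> \bar R)%E.
  by rewrite lee_fin kinetic_ge0.
have ik w : (0 <= \int[mu]_(t in J) (kinetic m w t)%:E)%E.
  by apply: integral_ge0.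
have mk y w (yw : velocities y w) D : measurable_fun D
    (fun t : TR => (kinetic m w t)%:E).
  by apply/measurable_EFinP; apply: measurable_funTS; exact: measurable_kinetic yw.
have kfin : (\int[mu]_(t in J) (kinetic m v t)%:E < +oo)%E.
  move: fx; rewrite (actionE T m0' hv); apply: le_lt_trans.
  by apply: leeDl; apply: integral_ge0 => t _; exact: potential_ge0.
have := leeD (hc r) (hc (- r)).
rewrite (actionE T m0' hv) !(actionE T m0' (hp _)) -/total_potential.
rewrite addeACA [leRHS]addeACA => h.
rewrite ge0_integralD//; last 4 first.
- by move=> t _; exact: potential_ge0.
- by apply: measurable_funTS; exact: measurable_pert_t.
- by move=> t _; exact: potential_ge0.
- by apply: measurable_funTS; exact: measurable_pert_t.
have kpar : (\int[mu]_(t in J) (kinetic m (perturbv T t0 k v r th) t)%:E +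
    \int[mu]_(t in J) (kinetic m (perturbv T t0 k v (- r) th) t)%:E <=
    2%:E * \int[mu]_(t in J) (kinetic m v t)%:E + (kinetic_cost * r ^+ 2)%:E)%E.
  have K0 : 0 <= m * n%:R * (2 * pi / T) ^+ 2 * r ^+ 2.
    apply: mulr_ge0; rewrite ?sqr_ge0//; apply: mulr_ge0; rewrite ?sqr_ge0//.
    exact: mulr_ge0.
  have -> : (kinetic_cost * r ^+ 2)%:E =
      (\int[mu]_(t in J) (m * n%:R * (2 * pi / T) ^+ 2 * r ^+ 2)%:E)%E.
    rewrite integral_cst//= -(fineK (_ : mu `[0%R, T] \is a fin_num)%E); last first.
      by rewrite ge0_fin_numE// itv_lty.
    rewrite fine_itv ?(ltW T0)// subr0 -EFinM; congr EFin; rewrite /kinetic_cost; ring.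
  rewrite -ge0_integralZl_EFin//; last first.
    exact: mk hv _.
  rewrite -!ge0_integralD//; last 4 first.
  - by move=> t _; rewrite mule_ge0.
  - by apply: measurable_funeM; exact: mk hv _.
  - exact: mk (hp _) _.
  - exact: mk (hp _) _.
  apply: ge0_le_integral => //.
  - by move=> t _; rewrite adde_ge0.
  - by apply: emeasurable_funD; [exact: mk (hp _) _|exact: mk (hp _) _].
  - by apply: emeasurable_funD => //; apply: measurable_funeM; exact: mk hv _.
  - move=> t _; rewrite -EFinM -!EFinD lee_fin.
    exact: kinetic_parallelogram.
have kf : (\int[mu]_(t in J) (kinetic m v t)%:E \is a fin_num)%E.
  by rewrite ge0_fin_numE.
have tf : total_potential \is a fin_num.
  rewrite ge0_fin_numE; first exact: total_potential_lty.
  by apply: integral_ge0 => t _; exact: potential_ge0.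
have := le_trans h (leeD kpar (lexx _)).
rewrite -(fineK kf) -(fineK tf) -?EFinD -?EFinM -?EFinD.
exact: cancel_kinetic.
Qed.

Variable a : R.
Hypotheses (a0 : 0 < a) (a1 : a <= 1).

Let mrect : measurable (polar_rect a). Proof. exact: measurable_polar_rect. Qed.

Let rect_measure : (mu2 (polar_rect a) <= pi%:E)%E.
Proof.
have muE (b c : R) : b <= c -> mu `[b, c] = (c - b)%:E.
  by move=> bc; rewrite -(fine_itv bc) fineK// ge0_fin_numE// itv_lty.
apply: (@le_trans _ _ (mu `[a, 1%R] * mu `[0%R, pi])%E).
  rewrite /polar_rect product_measure1E//; exact: measurable_itv.
rewrite !muE ?pi_ge0// subr0 -EFinM lee_fin ler_piMl ?pi_ge0//.
by rewrite lerBlDr lerDl ltW.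
Qed.

(** [competitors_le] integrated over [polar_rect a] with weight r^-2, which
    turns the kinetic cost, of order r^2, into a constant. *)
Lemma averaged_competitors :
  ((2 * fine total_potential * pi * (a^-1 - 1))%:E <= (kinetic_cost * pi)%:E +
   \int[mu]_(t in J) \int[mu2]_(z in polar_rect a) weighted_potential (t, z))%E.
Proof.
have tf : total_potential \is a fin_num.
  rewrite ge0_fin_numE; first exact: total_potential_lty.
  by apply: integral_ge0 => t _; exact: potential_ge0.
have X0 : 0 <= 2 * fine total_potential.
  rewrite mulr_ge0// fine_ge0//.
  by apply: integral_ge0 => t _; exact: potential_ge0.
rewrite -(integral_inv_sqr a0 a1 X0).
rewrite /polar_rect (@tonelli_rectangle_prod _ _ _ _ _ _ _ mu mu mu _ _ _ _
  measurable_weighted_potential weighted_potential_ge0 mJ (measurable_itv _)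
  (measurable_itv _)) -/(polar_rect a).
have mG : measurable_fun (polar_rect a)
    (fun z => \int[mu]_(t in J) weighted_potential (t, z))%E.
  apply: measurable_funTS.
  have mf' : measurable_fun setT
      (fun s : (TR * TR) * TR => weighted_potential (s.2, s.1)).
    apply: (measurableT_comp measurable_weighted_potential).
    by apply: measurable_fun_pair; [exact: measurable_snd|exact: measurable_fst].
  exact: (@measurable_tonelli_rectangle1 _ _ _ _ _ mu _ J mf'
    (fun s => weighted_potential_ge0 _) mJ).
have G0 z : (0 <= \int[mu]_(t in J) weighted_potential (t, z))%E.
  by apply: integral_ge0 => t _; exact: weighted_potential_ge0.
apply: (@le_trans _ _ (\int[mu2]_(z in polar_rect a)
  (kinetic_cost%:E + \int[mu]_(t in J) weighted_potential (t, z)))%E).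
  apply: ge0_le_integral.
  - exact: mrect.
  - by move=> z _; rewrite lee_fin mulr_ge0// invr_ge0 sqr_ge0.
  - by apply/measurable_EFinP; apply: measurable_funTS; measurability.
  - exact: emeasurable_funD.
  - move=> [r th] [/= + _]; rewrite in_itv /= => /andP[ar _].
    have r0 : 0 < r by rewrite (lt_le_trans a0).
    have r20 : 0 <= r ^- 2 by rewrite invr_ge0 sqr_ge0.
    have := competitors_le r th.
    rewrite -(@lee_pmul2l _ (r ^- 2)%:E) ?lte_fin ?invr_gt0 ?exprn_gt0//.
    rewrite -[in X in (X -> _)](fineK tf) -!EFinM => /le_trans; apply.
    rewrite ge0_muleDr; last 2 first.
    + by rewrite lee_fin mulr_ge0 ?sqr_ge0.
    + by apply: integral_ge0 => t _; rewrite adde_ge0 ?potential_ge0.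
    apply: leeD.
      by rewrite -EFinM lee_fin mulrC mulfK// expf_neq0// gt_eqF.
    rewrite -ge0_integralZl_EFin//.
    + by move=> t _; rewrite adde_ge0 ?potential_ge0.
    + apply: measurable_funTS; apply: emeasurable_funD; exact: measurable_pert_t.
rewrite ge0_integralD//.
apply: leeD => //.
by rewrite (integral_cst _ mrect) (EFinM kinetic_cost) lee_wpmul2l// lee_fin.
Qed.

Let pair_kernel_ge0 t p z : (0 <= pair_kernel T t0 k x t p z)%E.
Proof.
by rewrite mule_ge0 ?lee_fin ?invr_ge0 ?sqr_ge0// adde_ge0// invsqrt_ge0.
Qed.

Let integral_weighted_potential t :
  (\int[mu2]_(z in polar_rect a) weighted_potential (t, z) =
   \sum_(p <- pairs n) (m ^+ 2)%:E *
     \int[mu2]_(z in polar_rect a) pair_kernel T t0 k x t p z)%E.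
Proof.
transitivity (\int[mu2]_(z in polar_rect a)
  \sum_(p <- pairs n) (m ^+ 2)%:E * pair_kernel T t0 k x t p z)%E.
  by apply: eq_integral => -[r th] _; exact: potential_perturb.
rewrite ge0_integral_sum//.
- apply: eq_bigr => p _; rewrite ge0_integralZl_EFin ?sqr_ge0//.
  by apply: measurable_funTS; exact: measurable_weighted_kernel.
- move=> p; apply: measurable_funeM; apply: measurable_funTS.
  exact: measurable_weighted_kernel.
- by move=> p z _; rewrite mule_ge0 ?lee_fin ?sqr_ge0.
Qed.

Let cpa : 0 <= 2 * pi / a.
Proof. by rewrite divr_ge0 ?mulr_ge0 ?pi_ge0// ltW. Qed.

Let scaled_potential t : ((2 * pi / a)%:E * potential m (x t) =
  \sum_(p <- pairs n) (m ^+ 2)%:E *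
    ((2 * pi / a)%:E * invsqrt (sqnorm (x t p.1 - x t p.2))))%E.
Proof.
rewrite /potential ge0_sume_distrr; last first.
  by move=> p _; rewrite mule_ge0 ?invsqrt_ge0// lee_fin sqr_ge0.
by apply: eq_bigr => p _; rewrite muleCA.
Qed.

Let pair_le t p : (\int[mu2]_(z in polar_rect a) pair_kernel T t0 k x t p z <=
  (2 * pi / a)%:E * invsqrt (sqnorm (x t p.1 - x t p.2)))%E.
Proof. by rewrite sqnorm_split; apply: mean_kernel_le => //; exact: tail2_ge0. Qed.

Lemma mean_potential_le t :
  (\int[mu2]_(z in polar_rect a) weighted_potential (t, z) <=
   (2 * pi / a)%:E * potential m (x t))%E.
Proof.
rewrite integral_weighted_potential scaled_potential.
by apply: lee_sum => p _; rewrite lee_wpmul2l ?lee_fin ?sqr_ge0.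
Qed.

(** The gain is collected from the colliding pair; the others do no harm by
    [mean_kernel_le]. *)
Lemma mean_potential_gain t p l0 : p \in pairs n -> 0 < l0 ->
  l0 <= `|wave T t0 k p.1 t - wave T t0 k p.2 t| ->
  Num.sqrt (sqnorm (x t p.1 - x t p.2)) <= l0 * a / 4 ->
  (\int[mu2]_(z in polar_rect a) weighted_potential (t, z) +
   (m ^+ 2 * (4 * pi / (l0 * a ^+ 2)))%:E <=
   (2 * pi / a)%:E * potential m (x t))%E.
Proof.
move=> pn l00 l0l near_collision.
have up : uniq (pairs n) by rewrite filter_uniq// enum_uniq.
rewrite integral_weighted_potential scaled_potential.
rewrite (bigD1_seq p)//= [leRHS](bigD1_seq p)//= addeAC; apply: leeD.
  rewrite (EFinM (m ^+ 2)) -ge0_muleDr; last 2 first.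
  - by apply: integral_ge0 => z _.
  - rewrite lee_fin; apply: divr_ge0; first by rewrite mulr_ge0 ?pi_ge0.
    by apply: mulr_ge0; [exact: ltW|exact: sqr_ge0].
  rewrite lee_wpmul2l ?lee_fin ?sqr_ge0// sqnorm_split.
  apply: mean_kernel_gain => //; first exact: tail2_ge0.
  by rewrite -sqnorm_split.
by apply: lee_sum => q _; rewrite lee_wpmul2l ?lee_fin ?sqr_ge0.
Qed.

End averaging.

(** * A collision is impossible *)
Section contradiction.
Context {R : realType} (e n : nat).
Notation d := e.+2.
Notation TR := (measurableTypeR R).
Notation mu := (@lebesgue_measure R).
Notation mu2 := (mu \x mu)%E.
Variables (T m t0 : R) (x : R -> configuration R d n) (p : 'I_n * 'I_n).
Hypotheses (T0 : 0 < T) (n2 : (2 <= n)%N) (m0 : 0 < m).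
Hypothesis xmin : minimizer m T x.
Hypotheses (t00 : 0 <= t0) (t0T : t0 < T).
Hypotheses (pn : p \in pairs n) (collision : x t0 p.1 = x t0 p.2).

Local Notation J := (`[0%R, T]%classic : set TR).
Let k := p.1.

Lemma sqrt_sqnorm_le (u : 'rV[R]_d) (c : R) : 0 <= c ->
  (forall j, `|u 0 j| <= c) -> Num.sqrt (sqnorm u) <= d%:R * c.
Proof.
move=> c0 uc; have dc : 0 <= d%:R * c by rewrite mulr_ge0.
rewrite -[leRHS](ger0_norm dc) -sqrtr_sqr ler_wsqrtr//.
apply: (@le_trans _ _ (d%:R * c ^+ 2)).
  rewrite /sqnorm mulr_natl -[X in _ <= _ *+ X](card_ord d) -sumr_const.
  apply: ler_sum => j _; rewrite -[leLHS]real_normK ?num_real//.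
  by apply: lerXn2r; rewrite ?nnegrE.
by rewrite exprMn ler_wpM2r ?sqr_ge0// expr2 ler_peMl// ler1n.
Qed.

Lemma pair_gap : exists2 l0 : R, 0 < l0 & \forall t \near t0,
  l0 <= `|wave T t0 k p.1 t - wave T t0 k p.2 t|.
Proof.
have p12 : p.2 != k.
  move: pn; rewrite mem_filter => /andP[+ _].
  by rewrite /k neq_ltn => ->; rewrite orbT.
have := wave_t0 T t0 n2 p12; rewrite -subr_gt0; set D := _ - _ => D0.
exists (D / 2); first by rewrite divr_gt0.
have cw : wave T t0 k p.1 t - wave T t0 k p.2 t @[t --> t0] --> D.
  by apply: cvgB; exact: continuous_wave.
near=> t; apply: le_trans (ler_norm _).
have : `|D - (wave T t0 k p.1 t - wave T t0 k p.2 t)| <= D / 2.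
  by near: t; apply: cvgr_dist_le => //; rewrite divr_gt0.
by rewrite ler_norml => /andP[_]; lra.
Unshelve. all: by end_near. Qed.

(** Each coordinate of each of the two bodies moves by o(sqrt (t - t0)) after the
    collision. *)
Lemma pair_close (c K : R) : 0 < c -> 0 < K ->
  \forall a \near 0^'+, forall t, t0 <= t <= t0 + (K * a) ^+ 2 ->
    Num.sqrt (sqnorm (x t p.1 - x t p.2)) <= c * a.
Proof.
move=> c0 K0.
have [[[_ _ hx] _] _ _] := xmin; have [v xv] := velocities_exist hx.
have d0 : 0 < d%:R :> R by rewrite ltr0n.
have c1 : 0 < c / (2 * d%:R) by rewrite divr_gt0// mulr_gt0.
have small (i : 'I_n) : \forall a \near 0^'+, forall j : 'I_d, forall t : R,
    t0 <= t <= t0 + (K * a) ^+ 2 ->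
    `|x t i 0 j - x t0 i 0 j| <= c / (2 * d%:R) * a.
  apply: filter_forall => j.
  exact: (weak_derivative_small t0 (xv i j) c1 K0).
near=> a; move=> t tI; have a0 : 0 < a by near: a; exact: nbhs_right_gt.
apply: (@le_trans _ _ (d%:R * (c / d%:R * a))); last first.
  rewrite le_eqVlt; apply/orP; left; apply/eqP; field.
  by rewrite gt_eqF.
apply: sqrt_sqnorm_le => [|j]; first by rewrite mulr_ge0 ?ltW// divr_gt0.
rewrite !mxE.
have -> : x t p.1 0 j - x t p.2 0 j =
    (x t p.1 0 j - x t0 p.1 0 j) - (x t p.2 0 j - x t0 p.2 0 j).
  by rewrite collision; ring.
apply: le_trans (ler_normB _ _) _.
have -> : c / d%:R * a = c / (2 * d%:R) * a + c / (2 * d%:R) * a.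
  by field; rewrite gt_eqF.
by apply: lerD; move: j t tI; near: a; exact: small.
Unshelve. all: by end_near. Qed.

Let X := fine (total_potential T m x).
Let C := kinetic_cost n T m.

(** For small a the pair stays within l0 a / 4 during (K a)^2, where the gain
    per unit of time is 4 pi m^2 / (l0 a^2); the powers of a cancel. The averaged
    minimality bounds the total gain by pi times the kinetic cost plus the part
    2 pi X of the potential that comes from the weight 1 / a - 1 in place of
    1 / a. *)
Lemma gain_bound (l0 K : R) : 0 < l0 -> 0 < K ->
  (\forall t \near t0, l0 <= `|wave T t0 k p.1 t - wave T t0 k p.2 t|) ->
  4 * m ^+ 2 * K ^+ 2 <= l0 * (C + 2 * X).
Proof.
move=> l00 K0 [del /= del0 gap].
have l4 : 0 < l0 / 4 by rewrite divr_gt0.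
have Ka : (K * a) ^+ 2 @[a --> 0^'+] --> (0 : R).
  apply: cvg_at_right_filter.
  rewrite [X in _ --> X](_ : 0 = (K * 0) ^+ 2); last by rewrite mulr0 expr0n.
  apply: (@cvg_comp _ _ _ (fun a => K * a) (fun x => x ^+ 2)).
    by apply: cvgM; [exact: cvg_cst|exact: cvg_id].
  exact: exprn_continuous.
have Tt0 : 0 < T - t0 by rewrite subr_gt0.
near (0 : R)^'+ => a.
have a0 : 0 < a by near: a; exact: nbhs_right_gt.
have a1 : a <= 1 by near: a; exact: nbhs_right_le.
have KaT : (K * a) ^+ 2 <= T - t0.
  by near: a; exact: cvgr_le Ka _ Tt0.
have Kadel : (K * a) ^+ 2 < del by near: a; exact: cvgr_lt Ka _ del0.
have close : forall t, t0 <= t <= t0 + (K * a) ^+ 2 ->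
    Num.sqrt (sqnorm (x t p.1 - x t p.2)) <= l0 * a / 4.
  move=> t ht; rewrite mulrAC; move: t ht; near: a; exact: pair_close.
have {}gap t : t0 <= t <= t0 + (K * a) ^+ 2 ->
    l0 <= `|wave T t0 k p.1 t - wave T t0 k p.2 t|.
  move=> /andP[t1 t2]; apply: gap; rewrite /ball_ /= distrC ger0_norm.
    by rewrite ltrBlDl (le_lt_trans t2)// ltrD2l.
  by rewrite subr_ge0.
pose g := m ^+ 2 * (4 * pi / (l0 * a ^+ 2)).
have g0 : 0 <= g.
  apply: mulr_ge0; first exact: sqr_ge0.
  apply: divr_ge0; first by rewrite mulr_ge0 ?pi_ge0.
  by apply: mulr_ge0; [exact: ltW|exact: sqr_ge0].
pose F t := (\int[mu2]_(z in polar_rect a) weighted_potential T t0 m k x (t, z))%E.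
pose bad : set TR := `[t0, t0 + (K * a) ^+ 2]%classic.
have mbad : measurable bad by exact: measurable_itv.
have mu_bad : mu bad = ((K * a) ^+ 2)%:E.
  have bb : t0 <= t0 + (K * a) ^+ 2 by rewrite lerDl sqr_ge0.
  transitivity (fine (mu `[t0, t0 + (K * a) ^+ 2]))%:E.
    by rewrite fineK// ge0_fin_numE// itv_lty.
  by rewrite fine_itv// addrAC subrr add0r.
have badJ : bad `<=` J.
  move=> t; rewrite /bad /= !in_itv /= => /andP[t1 t2].
  by rewrite (le_trans t00)//= (le_trans t2)// -lerBrDl.
have F0 t : (0 <= F t)%E by apply: integral_ge0 => z _; exact: weighted_potential_ge0.
have [v xv] : exists v, velocities x v.
  by have [[[_ _ hx] _] _ _] := xmin; exact: velocities_exist.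
have mpot : measurable_fun setT (fun t : TR => potential m (x t)).
  apply: measurable_potential => i j; exact: velocities_measurable xv.
have mF : measurable_fun J F.
  apply: measurable_funTS; rewrite /F /polar_rect.
  have h := (@measurable_tonelli_rectangle_prod _ _ _ _ _ _ _ mu mu _ _ _
    (measurable_weighted_potential t0 k xmin)
    (weighted_potential_ge0 _ _ _ _ _) (measurable_itv `[a, 1]) (measurable_itv `[0, pi])).
  exact: h.
have tf : total_potential T m x \is a fin_num.
  rewrite ge0_fin_numE; first exact: total_potential_lty.
  by apply: integral_ge0 => t _; exact: potential_ge0.
have c0 : 0 <= 2 * pi / a.
  by apply: divr_ge0; [rewrite mulr_ge0 ?pi_ge0|exact: ltW].
have pointwise t : (F t + (g * \1_bad t)%:E <=
    (2 * pi / a)%:E * potential m (x t))%E.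
  rewrite indicE; have [tb|tb] := pselect (bad t).
    rewrite mem_set// mulr1; move: tb; rewrite /bad /= in_itv /= => tb.
    by apply: (@mean_potential_gain _ _ _ _ _ _ _ _ _ a0 a1 _ p l0) => //; [exact: gap|exact: close].
  rewrite memNset// mulr0 adde0; exact: mean_potential_le.
have below : (\int[mu]_(t in J) F t + (g * (K * a) ^+ 2)%:E <=
    (2 * pi / a * X)%:E)%E.
  rewrite [leRHS]EFinM /X fineK// -ge0_integralZl_EFin//; last 2 first.
  - by move=> t _; exact: potential_ge0.
  - exact: measurable_funTS.
  have -> : (g * (K * a) ^+ 2)%:E = (\int[mu]_(t in J) (g * \1_bad t)%:E)%E.
    under eq_integral do rewrite EFinM.
    rewrite ge0_integralZl_EFin//; last first.
      by apply/measurable_EFinP; apply: measurable_funTS; exact: measurable_indic.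
    rewrite integral_indic// (setIidl badJ) EFinM; congr (_ * _)%E.
    exact/esym/mu_bad.
  have mi : measurable_fun J (fun t => (g * \1_bad t)%:E).
    apply/measurable_EFinP; apply: measurable_funM; first exact: measurable_cst.
    exact: measurable_indic.
  rewrite -ge0_integralD//; last by move=> t _; rewrite lee_fin mulr_ge0.
  apply: ge0_le_integral => //.
  - by move=> t _; rewrite adde_ge0// lee_fin mulr_ge0.
  - exact: emeasurable_funD.
  - by apply: measurable_funeM; exact: measurable_funTS.
have above := averaged_competitors t0 k T0 n2 m0 xmin a0 a1.
have If : (\int[mu]_(t in J) F t \is a fin_num)%E.
  rewrite ge0_fin_numE; last by apply: integral_ge0.
  apply: le_lt_trans (ltry (2 * pi / a * X)); apply: le_trans below.
  by rewrite leeDl// lee_fin mulr_ge0// sqr_ge0.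
move: above below; rewrite -/F -(fineK If) -/X -/C.
set I := fine _; rewrite -!EFinD !lee_fin => above below.
have gE : g * (K * a) ^+ 2 = pi * (4 * m ^+ 2 * K ^+ 2 / l0).
  by rewrite /g; field; rewrite !gt_eqF.
have : pi * (4 * m ^+ 2 * K ^+ 2 / l0) <= pi * (C + 2 * X).
  rewrite -gE.
  have -> : pi * (C + 2 * X) = C * pi + (2 * pi / a * X -
    2 * X * pi * (a^-1 - 1)) by field; rewrite gt_eqF.
  move: above below; set u := 2 * X * pi * _; set w := 2 * pi / a * X.
  set h := g * _; move: (C * pi) => c uI hI.
  rewrite -subr_ge0 (_ : _ - h = (c + I - u) + (w - (I + h))); last by ring.
  by rewrite addr_ge0 ?subr_ge0.
by rewrite ler_pM2l ?pi_gt0// ler_pdivrMr// [_ * l0]mulrC.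
Unshelve. all: by end_near. Qed.

(** The constant K in [gain_bound] is arbitrary; the choice below exceeds the
    bound for K^2, and K <= K^2. *)
Lemma no_pair_collision : False.
Proof.
have [l0 l00 gap] := pair_gap.
have X0 : 0 <= X.
  by apply: fine_ge0; apply: integral_ge0 => t _; exact: potential_ge0.
have C0 : 0 <= C.
  apply: mulr_ge0; last exact: ltW.
  by apply: mulr_ge0; rewrite ?sqr_ge0// mulr_ge0// ltW.
have m20 : 0 < 4 * m ^+ 2 by rewrite mulr_gt0// exprn_gt0.
have q0 : 0 <= l0 * (C + 2 * X) / (4 * m ^+ 2).
  apply: divr_ge0; last exact: ltW.
  by apply: mulr_ge0; [exact: ltW|rewrite addr_ge0// mulr_ge0].
pose K := 1 + l0 * (C + 2 * X) / (4 * m ^+ 2).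
have K1 : 1 <= K by rewrite lerDl.
have K0 : 0 < K by exact: lt_le_trans K1.
have := gain_bound l00 K0 gap; apply/negP; rewrite -ltNge.
rewrite -ltr_pdivrMl// mulrC.
apply: (@lt_le_trans _ _ K); first by rewrite /K ltrDr.
by rewrite expr2 ler_peMr// ltW.
Qed.

End contradiction.

Lemma periodic_int {R : realType} (V : zmodType) (f : R -> V) (T : R) :
  periodic f T -> forall (z : int) (t : R), f (t + z%:~R * T) = f t.
Proof.
move=> pf [k|k] t.
  elim: k t => [|k IH] t; first by rewrite mul0r addr0.
  by rewrite intS intrD mulrDl mul1r addrCA addrC pf IH.
have fN u : f (u - T) = f u by rewrite -[in RHS](subrK T u) pf.
elim: k t => [|k IH] t; first by rewrite mulN1r fN.
rewrite NegzE -addn1 PoszD opprD intrD mulrDl mulN1r addrA fN.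
by rewrite -NegzE IH.
Qed.

(** By periodicity the collision may be moved to [0, T), which leaves room after
    it inside the period, and the pair may be ordered. *)
Lemma choreography_minimizer_collision_free (R : realType) (e n : nat)
    (hn : (2 <= n)%N) (T : R) (hT : 0 < T) (m : R) (hm : 0 < m)
    (x : R -> configuration R e.+2 n) (hx : minimizer m T x) :
  forall t : R, collision_free (x t).
Proof.
move=> t i j ij; apply/eqP => xij.
pose t0 := t + (- Num.floor (t / T))%:~R * T.
have t0E : t0 = t - (Num.floor (t / T))%:~R * T.
  by rewrite /t0 intrN mulNr.
have t00 : 0 <= t0.
  by rewrite t0E subr_ge0 -ler_pdivlMr// ge_floor.
have t0T : t0 < T.
  rewrite t0E ltrBlDr -[X in X + _]mul1r -mulrDl -ltr_pdivrMr//.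
  by rewrite addrC -intrD1 floorD1_gt.
have xt0 (q : 'I_n) : x t0 q = x t q.
  have [[[_ px _] _] _ _] := hx.
  exact: (periodic_int (px q)).
have {}xij : x t0 i = x t0 j by rewrite !xt0.
wlog lt_ij : i j ij xij / (i < j)%N => [h|].
  move: (ij); rewrite neq_ltn => /orP[?|?]; first exact: (h i j).
  by apply: (h j i) => //; rewrite eq_sym.
apply: (@no_pair_collision R e n T m t0 x (i, j)) => //.
by rewrite mem_filter lt_ij mem_enum.
Qed.

Theorem mainTheorem2 (R : realType) (d : nat) (hd : d = 2%N \/ d = 3%N)
    (n : nat) (hn : (2 <= n)%N) (T : R) (hT : 0 < T) (m : R) (hm : 0 < m)
    (x : R -> configuration R d n) (hx : minimizer m T x) :
  forall t : R, collision_free (x t).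
Proof.
case: hd => hd; subst d.
  exact: (choreography_minimizer_collision_free (e := 0) hn hT hm hx).
exact: (choreography_minimizer_collision_free (e := 1) hn hT hm hx).
Qed.
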